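(* Let $S$ be a compact Polish space, $\mu^*\in P(S)$, $\varepsilon\ge 0$, $G\in\mathcal{G}$, and let $(K_s)_{s\in S}$ be a family of subsets $K_s\subseteq P(S)$. Assume that $c:S\times S\to\mathbb{R}_+$ is non-negative, continuous, and such that $c(s,r)=0$ if and only if $s=r$, and that $\ell(\cdot,G)$ is continuous. Assume additionally that $K_s$ is non-empty, weakly* closed and convex for $\mu^*$-a.e. $s\in S$. If $\Omega_{K,c,\varepsilon}$ is also non-empty, then $$I_{\Omega_{K,c,\varepsilon}}(G)=\inf_{(\lambda,h)\in\Delta_{G,\ell,c}}\left(\lambda\varepsilon+\sup_{\pi_{S|S}:S\to K_s}\int_S\int_S h(s,r)\,d\pi_{S|S=s}(r)\,d\mu^*(s)\right).$$
   Context: $P(S)$ is the set of Borel probability measures on $S$; weak* closedness in $P(S)$ refers to the duality with $C(S)$. $\mathcal{G}$ is a parameter space and $\ell:S\times\mathcal{G}\to[0,\infty)$ is a measurable loss function. The notation $\pi_{S|S}:S\to K_s$ means a $\mu^*$-measurable kernel $s\mapsto\pi_{S|S=s}\in P(S)$ such that $\pi_{S|S=s}\in K_s$ for $\mu^*$-a.e. $s\in S$. Define $$\Omega_{K,c,\varepsilon}:=\Big\{\pi_{S|S}:S\to K_s\ :\ \int_S\int_S c(s,r)\,d\pi_{S|S=s}(r)\,d\mu^*(s)\le\varepsilon\Big\},$$ $$I_{\Omega_{K,c,\varepsilon}}(G):=\sup_{\pi_{S|S}\in\Omega_{K,c,\varepsilon}}\int_S\int_S\ell(r,G)\,d\pi_{S|S=s}(r)\,d\mu^*(s),$$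 and let $\Delta_{G,\ell,c}$ be the set of pairs $(\lambda,h)$ with $\lambda\in\mathbb{R}_+=[0,\infty)$ and $h\in C(S\times S)$ such that $$\int_S\int_S h(s,r)\,d\pi_{S|S=s}(r)\,d\mu^*(s)\ \ge\ \int_S\int_S\big(\ell(r,G)-\lambda c(s,r)\big)\,d\pi_{S|S=s}(r)\,d\mu^*(s)\quad\text{for all }\pi_{S|S}:S\to K_s.$$ *)

(* Defs.v *)
From HB Require Import structures.
From mathcomp Require Import all_boot all_order all_algebra.
From mathcomp Require Import all_classical all_reals all_analysis.

Set Implicit Arguments.
Unset Strict Implicit.
Unset Printing Implicit Defensive.

Import Order.TTheory GRing.Theory Num.Theory.
Import numFieldNormedType.Exports.

Local Open Scope classical_set_scope.
Local Open Scope ring_scope.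

Definition separable_space (T : topologicalType) : Prop :=
  exists2 D : set T, countable D & dense D.

Definition completely_metrizable (R : realType) (T : topologicalType) : Prop :=
  exists (M : metricType R) (f : T -> M) (g : M -> T),
    [/\ cancel f g, cancel g f, continuous f, continuous g &
        forall F : set_system M, ProperFilter F -> cauchy F -> exists x : M, F --> x].

Definition polish_space (R : realType) (T : topologicalType) : Prop :=
  separable_space T /\ completely_metrizable R T.

(* [S] with its Borel sigma-algebra; the alias only carries the measurable
   structure, the topology stays on [S] itself. *)
Notation borel S := (g_sigma_algebraType (@open S)).

Definition weak_star_eval (R : realType) (S : ptopologicalType)
    (P : probability (borel S) R) : {ptws continuousType S R -> R} :=
  fun f => \int[P]_x f x.

(* The weak* topology on P(S) is the initial topology of the maps
   P |-> \int f dP, f in C(S). *)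
Definition weak_star_closed (R : realType) (S : ptopologicalType)
    (K : set (probability (borel S) R)) : Prop :=
  closed (K : set (initial_topology (@weak_star_eval R S))).

(* A [probability] is a function on all sets, constrained only on measurable
   ones; so the mixture [M] is determined by its values on Borel sets only. *)
Definition convex_probabilities (R : realType) (S : ptopologicalType)
    (K : set (probability (borel S) R)) : Prop :=
  forall (P Q M : probability (borel S) R) (t : R),
    K P -> K Q -> 0 <= t <= 1 ->
    (forall A : set (borel S), measurable A ->
      M A = (t%:E * P A + (1 - t)%:E * Q A)%E) ->
    K M.

(* mu-measurability of s |-> p s is measurability for the Caratheodory
   sigma-algebra of the outer measure mu^*, which for a finite measure is the
   mu-completion of the Borel sigma-algebra. *)
Definition kernel_in (R : realType) (S : ptopologicalType)
    (mu : probability (borel S) R) (K : S -> set (probability (borel S) R)) :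
    set (S -> probability (borel S) R) :=
  [set p | measurable_fun [set: caratheodory_type (mu^*)%mu]
             (p : caratheodory_type (mu^*)%mu -> pprobability (borel S) R) /\
           \forall s \ae mu, K s (p s)].

(* The outer integral is taken against the completion of mu, since
   s |-> \int h(s, r) dp_s(r) need not be Borel measurable. *)
Definition kernel_integral (R : realType) (S : ptopologicalType)
    (mu : probability (borel S) R) (p : S -> probability (borel S) R)
    (h : S * S -> R) : \bar R :=
  (\int[@completed_measure_extension _ (borel S) R mu]_s \int[p s]_r (h (s, r))%:E)%E.

Definition Omega (R : realType) (S : ptopologicalType)
    (mu : probability (borel S) R) (K : S -> set (probability (borel S) R))
    (c : S * S -> R) (eps : R) : set (S -> probability (borel S) R) :=
  [set p | kernel_in mu K p /\ (kernel_integral mu p c <= eps%:E)%E].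

Definition I_Omega (R : realType) (S : ptopologicalType)
    (mu : probability (borel S) R) (K : S -> set (probability (borel S) R))
    (c : S * S -> R) (eps : R) (Gam : Type) (ell : S -> Gam -> R) (G : Gam) :
    \bar R :=
  ereal_sup [set kernel_integral mu p (fun sr => ell sr.2 G)
            | p in Omega mu K c eps].

Definition Delta (R : realType) (S : ptopologicalType)
    (mu : probability (borel S) R) (K : S -> set (probability (borel S) R))
    (c : S * S -> R) (Gam : Type) (ell : S -> Gam -> R) (G : Gam) :
    set (R * (S * S -> R)) :=
  [set lh : R * (S * S -> R) | [/\ 0 <= lh.1, continuous lh.2 &
     forall p, kernel_in mu K p ->
       (kernel_integral mu p (fun sr => ell sr.2 G - lh.1 * c sr)%R <=
        kernel_integral mu p lh.2)%E]].

(* Main.v *)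
(* The inequality [<=] is weak duality. For [>=], restrict to [h = ell - lam c]:
   it remains to find, for every [v > I_Omega], a slope [lam >= 0] with
   [L p <= v + lam (C p - eps)] for all kernels [p], where [C] and [L] are the
   integrals of [c] and [ell]. As [C] and [L] are affine on a convex set of
   kernels, such a slope exists as soon as [L <= v] persists on
   [C < eps + eta] for some [eta > 0]; otherwise there are kernels [p_j] with
   [C p_j <= eps + 1/j] and [L p_j >= v], and a limit kernel contradicts
   [v > I_Omega].

   The limit is found without any measurability of [s |-> K s]. Let [psi_m]
   be a sequence of functions whose span is dense in [C(S)]. Choosing the [p_j]
   almost minimal for the convex functional
   [sum_m 2^-m int (int psi_m dp_s)^2 dmu(s)], the parallelogram law makes
   [int psi_m d(p_j)_s] Cauchy for almost every [s]. For such [s], the limit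
   of [int f d(p_j)_s] is a positive functional of [f], hence by the Riesz
   representation theorem a probability measure, which is in [K s] as [K s]
   is weak* closed.

   The cost [c] is used in place of a metric on [S]. *)
Require Import Defs.
From HB Require Import structures.
From mathcomp Require Import all_boot all_order all_algebra.
From mathcomp Require Import all_classical all_reals all_analysis.
From mathcomp Require Import measurable_realfun ring lra.

Set Implicit Arguments.
Unset Strict Implicit.
Unset Printing Implicit Defensive.

Import Order.TTheory GRing.Theory Num.Theory.
Import numFieldNormedType.Exports.

Local Open Scope classical_set_scope.
Local Open Scope ring_scope.

(** * Continuous real functions and compactness *)

Section continuous_real_functions.
Context {R : realType} {T : topologicalType}.
Implicit Types f g : T -> R.

Lemma continuousfD f g : continuous f -> continuous g ->
  continuous (fun x => f x + g x).
Proof. by move=> cf cg x; apply: cvgD; [exact: cf|exact: cg]. Qed.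

Lemma continuousfB f g : continuous f -> continuous g ->
  continuous (fun x => f x - g x).
Proof. by move=> cf cg x; apply: cvgB; [exact: cf|exact: cg]. Qed.

Lemma continuousfM f g : continuous f -> continuous g ->
  continuous (fun x => f x * g x).
Proof. by move=> cf cg x; apply: cvgM; [exact: cf|exact: cg]. Qed.

Lemma continuousf_cst (r : R) : continuous (fun _ : T => r).
Proof. by move=> x; exact: cvg_cst. Qed.

Lemma continuousf_min f g : continuous f -> continuous g ->
  continuous (fun x => Num.min (f x) (g x)).
Proof. by move=> cf cg x; apply: continuous_min; [exact: cf|exact: cg]. Qed.

Lemma continuousf_max f g : continuous f -> continuous g ->
  continuous (fun x => Num.max (f x) (g x)).
Proof. by move=> cf cg x; apply: continuous_max; [exact: cf|exact: cg]. Qed.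

Lemma continuousf_norm f : continuous f -> continuous (fun x => `|f x|).
Proof. by move=> cf x; apply: cvg_norm; exact: cf. Qed.

Lemma continuousf_sum (I : Type) (s : seq I) (P : pred I) (F : I -> T -> R) :
  (forall i, continuous (F i)) ->
  continuous (fun x => \sum_(i <- s | P i) F i x).
Proof.
move=> cF; elim: s => [|i s IH].
  by under eq_fun do rewrite big_nil; exact: continuousf_cst.
under eq_fun do rewrite big_cons.
by case: (P i) => //; exact: continuousfD.
Qed.

Lemma continuousf_div f g : continuous f -> continuous g ->
  (forall x, g x != 0) -> continuous (fun x => f x / g x).
Proof.
move=> cf cg g0 x; apply: cvgM; first exact: cf.
by apply: cvgV; [exact: g0|exact: cg].
Qed.

Lemma closed_ge f (a : R) : continuous f -> closed [set x | a <= f x].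
Proof.
move=> cf; rewrite -[X in closed X]/(f @^-1` [set y | a <= y]).
by apply: closed_comp => [x _|]; [exact: cf|exact: closed_ge].
Qed.

Lemma open_gt f (a : R) : continuous f -> open [set x | a < f x].
Proof.
move=> cf; rewrite -[X in open X]/(f @^-1` [set y | a < y]).
by apply: open_comp => [x _|]; [exact: cf|exact: open_gt].
Qed.

Hypothesis T_compact : compact [set: T].

Lemma compact_gt0 (F : set T) f : closed F -> continuous f ->
  (forall x, F x -> 0 < f x) -> exists2 d : R, 0 < d & forall x, F x -> d <= f x.
Proof.
move=> cF cf f0; have [->|F0] := eqVneq F set0; first by exists 1.
have cptF : compact F by apply: (subclosed_compact cF T_compact).
have [||z zF fz] := @compact_EVT_min T R f F _ cptF.
- exact/set0P.
- exact: continuous_subspaceT.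
- by exists (f z) => [|x xF]; [apply: f0; rewrite inE in zF|apply: fz; rewrite inE].
Qed.

Lemma compact_bounded f : continuous f ->
  exists2 M : R, 0 <= M & forall x, `|f x| <= M.
Proof.
move=> cf; have [[x0]|T0] := pselect (exists x : T, True); last first.
  by exists 0 => // x; exfalso; apply: T0; exists x.
have [|||z _ fz] := @compact_EVT_max T R (fun x => `|f x|) [set: T].
- by exists x0.
- exact: T_compact.
- by apply: continuous_subspaceT; exact: continuousf_norm.
by exists `|f z| => // x; apply: fz; rewrite inE.
Qed.

End continuous_real_functions.

(** Plays the part of Urysohn functions. On [U] the values are eventually equal to [1], not merely
    convergent to [1], so at each point of [U] a finite stage already gives the full indicator. *)
Definition open_indic_approximable (R : realType) (S : topologicalType) : Prop :=
  forall U : set S, open U ->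
  exists f : nat -> S -> R, [/\ forall m, continuous (f m),
    forall m r, 0 <= f m r <= 1,
    forall r, {homo f ^~ r : p q / (p <= q)%N >-> p <= q},
    forall m r, ~ U r -> f m r = 0 &
    forall r, U r -> \forall m \near \oo, f m r = 1].

(** * Partitions of unity and uniform approximation built from the cost *)

Section separating_cost.
Context {R : realType} {S : ptopologicalType}.
Variable c : S * S -> R.
Hypothesis S_compact : compact [set: S].
Hypothesis c_ge0 : forall sr, 0 <= c sr.
Hypothesis c_continuous : continuous c.
Hypothesis c_eq0 : forall s r, c (s, r) = 0 <-> s = r.

Lemma cost_continuous x : continuous (fun r => c (x, r)).
Proof.
move=> r; apply: (@continuous_comp _ _ _ (fun r => (x, r)) c).
  by apply: cvg_pair; [exact: cvg_cst|exact: cvg_id].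
exact: c_continuous.
Qed.

(* On the compact set of triples [(s, (x, r))] with
   [e <= |h (s, r) - h (s, x)|] the cost [c (x, r)] is positive, hence bounded
   away from [0]. *)
Lemma cost_unif_continuous (h : S * S -> R) (e : R) : continuous h -> 0 < e ->
  exists2 d : R, 0 < d &
    forall s x r, c (x, r) < d -> `|h (s, r) - h (s, x)| < e.
Proof.
move=> ch e0.
have cptSSS : compact [set: S * (S * S)].
  by rewrite -setXTT; apply: compact_setX => //; rewrite -setXTT; exact: compact_setX.
pose g (t : S * (S * S)) : R := `|h (t.1, t.2.2) - h (t.1, t.2.1)|.
have cg : continuous g.
  apply: continuousf_norm; apply: continuousfB => t.
    apply: (@continuous_comp _ _ _ (fun t : S * (S * S) => (t.1, t.2.2)) h); last exact: ch.
    apply: cvg_pair; first exact: cvg_fst.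
    by apply: (@cvg_comp _ _ _ snd snd _ _ _ cvg_snd); exact: cvg_snd.
  apply: (@continuous_comp _ _ _ (fun t : S * (S * S) => (t.1, t.2.1)) h); last exact: ch.
  apply: cvg_pair; first exact: cvg_fst.
  by apply: (@cvg_comp _ _ _ snd fst _ _ _ cvg_snd); exact: cvg_fst.
have [|||d d0 dP] := @compact_gt0 R _ cptSSS [set t | e <= g t] (fun t => c t.2).
- exact: closed_ge.
- by move=> t; apply: (@continuous_comp _ _ _ snd c); [exact: cvg_snd|exact: c_continuous].
- move=> [s [x r]]; rewrite /= lt_neqAle c_ge0 andbT => eg; apply/eqP => /esym/c_eq0 xr.
  by move: eg; rewrite /g /= xr subrr normr0 leNgt e0.
exists d => // s x r xrd; rewrite ltNge; apply/negP => /(dP (s, (x, r))) /=.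
by rewrite leNgt xrd.
Qed.

(** Substitute for the triangle inequality. On the compact set of pairs [(y, r)] with [r] outside
    [U], the sum [c (y, x) + c (y, r)] vanishes only if [x = y = r], which [U x] excludes; so it has
    a positive lower bound, and half of that bound serves. *)
Lemma cost_nbhs_basis (U : set S) : open U ->
  forall x, U x -> exists2 d : R, 0 < d &
    forall y r, c (y, x) < d -> c (y, r) < d -> U r.
Proof.
move=> oU x Ux.
have cptSS : compact [set: S * S] by rewrite -setXTT; exact: compact_setX.
have [|||d d0 dP] := @compact_gt0 R _ cptSS [set t : S * S | ~ U t.2]
  (fun t => c (t.1, x) + c t).
- rewrite -[X in closed X]/(snd @^-1` ~` U).
  apply: closed_comp => [t _|]; first exact: cvg_snd.
  exact: open_closedC.
- apply: continuousfD => // t.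
  apply: (@continuous_comp _ _ _ (fun t : S * S => (t.1, x)) c); last exact: c_continuous.
  by apply: cvg_pair; [exact: cvg_fst|exact: cvg_cst].
- move=> [y r] /= Ur; rewrite lt_neqAle addr_ge0// andbT eq_sym paddr_eq0//.
  apply/negP => /andP[/eqP/c_eq0 yx /eqP/c_eq0 yr].
  by apply: Ur; rewrite -yr yx.
exists (d / 2); first by rewrite divr_gt0.
move=> y r yx yr; apply: contrapT => Ur.
have /= := dP (y, r) Ur; rewrite leNgt => /negP; apply.
by rewrite [ltRHS]splitr ltrD.
Qed.

(** The sets where [c (x, r) < d] form an open cover of [S]; the bumps [max 0 (d - c (x i, r))] at
    the centres of a finite subcover are divided by their sum. *)
Lemma cost_partition_of_unity (d : R) : 0 < d ->
  exists n (x : nat -> S) (psi : nat -> S -> R),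
  [/\ forall i, continuous (psi i), forall i r, 0 <= psi i r <= 1,
      forall r, \sum_(i < n) psi i r = 1 &
      forall i r, psi i r != 0 -> c (x i, r) < d].
Proof.
move=> d0; have := S_compact; rewrite compact_cover.
move=> /(_ _ setT (fun x => [set r | c (x, r) < d])) [||D _ DT].
- move=> x _; rewrite (_ : [set r | _] = [set r | 0 < d - c (x, r)]); last first.
    by apply/seteqP; split => r /=; rewrite subr_gt0.
  apply: open_gt.
  by apply: continuousfB; [exact: continuousf_cst|exact: cost_continuous].
- by move=> x _; exists x => //=; rewrite (c_eq0 x x).2.
pose x i := nth point (finmap.enum_fset D) i.
pose n := size (finmap.enum_fset D).
pose phi i r := Num.max 0 (d - c (x i, r)).
have phi_ge0 i r : 0 <= phi i r by rewrite le_max lexx.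
have phi_gt0 i r : phi i r != 0 -> c (x i, r) < d.
  rewrite /phi ltNge; apply: contra => dc; apply/eqP/max_idPl.
  by rewrite subr_le0.
have cphi i : continuous (phi i).
  apply: continuousf_max; first exact: continuousf_cst.
  by apply: continuousfB; [exact: continuousf_cst|exact: cost_continuous].
pose s r := \sum_(i < n) phi i r.
have cs : continuous s by exact: continuousf_sum.
have s_gt0 r : 0 < s r.
  have [y /= yD yr] := DT r I.
  have iy : (index y (finmap.enum_fset D) < n)%N by rewrite index_mem.
  rewrite /s (bigD1 (Ordinal iy))//= ltr_pwDl//; last by apply: sumr_ge0.
  by rewrite /phi /x nth_index// lt_max subr_gt0 yr orbT.
(* Past [n] the functions are [0], so the bounds hold for every natural index and the support
   condition is void there. *)
exists n, x, (fun i r => if (i < n)%N then phi i r / s r else 0); split.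
- move=> i; have [_|_] := ltnP i n; last exact: continuousf_cst.
  by apply: continuousf_div => // r; rewrite gt_eqF.
- move=> i r; case: ifPn => [ni|_]; last by rewrite lexx ler01.
  rewrite divr_ge0 ?(ltW (s_gt0 _))//= ler_pdivrMr// mul1r.
  by rewrite /s (bigD1 (Ordinal ni))//= lerDl sumr_ge0.
- move=> r; under eq_bigr => i _ do rewrite ltn_ord.
  by rewrite -mulr_suml -/(s r) divff ?(gt_eqF (s_gt0 r)).
- move=> i r; case: ifPn => [_|_]; last by rewrite eqxx.
  by rewrite mulf_eq0 negb_or => /andP[/phi_gt0 ? _].
Qed.

Lemma countable_partition_of_unity :
  exists (n : nat -> nat) (x : nat -> nat -> S) (psi : nat -> nat -> S -> R),
  [/\ forall k i, continuous (psi k i), forall k i r, 0 <= psi k i r <= 1,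
      forall k r, \sum_(i < n k) psi k i r = 1 &
      forall k i r, psi k i r != 0 -> c (x k i, r) < k.+1%:R^-1].
Proof.
have /choice[F FP] : forall k, exists F : nat * (nat -> S) * (nat -> S -> R),
  [/\ forall i, continuous (F.2 i), forall i r, 0 <= F.2 i r <= 1,
      forall r, \sum_(i < F.1.1) F.2 i r = 1 &
      forall i r, F.2 i r != 0 -> c (F.1.2 i, r) < k.+1%:R^-1].
  move=> k; have [|n [x [psi H]]] := @cost_partition_of_unity k.+1%:R^-1.
    by rewrite invr_gt0.
  by exists (n, x, psi).
exists (fun k => (F k).1.1), (fun k => (F k).1.2), (fun k => (F k).2).
by split => k; have [] := FP k.
Qed.

Section approximation.
Variables (n : nat -> nat) (x : nat -> nat -> S) (psi : nat -> nat -> S -> R).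
Hypothesis psi_continuous : forall k i, continuous (psi k i).
Hypothesis psi01 : forall k i r, 0 <= psi k i r <= 1.
Hypothesis psi_sum : forall k r, \sum_(i < n k) psi k i r = 1.
Hypothesis psi_supp : forall k i r, psi k i r != 0 -> c (x k i, r) < k.+1%:R^-1.

(** [h (s, r)] is the average of itself with weights [psi k i r], and only nodes [x k i] close to
    [r] carry weight. The bound is uniform in [s], and the approximation separates the variables [s]
    and [r]. *)
Lemma psi_approx (h : S * S -> R) (e : R) : continuous h -> 0 < e ->
  exists k, forall s r,
    `|h (s, r) - \sum_(i < n k) h (s, x k i) * psi k i r| <= e.
Proof.
move=> ch e0; have [d d0 dP] := cost_unif_continuous ch e0.
have [k _ /(_ _ (leqnn k)) kd] : \forall k \near \oo, k.+1%:R^-1 < d :> R.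
  by near=> k; near: k; exact: near_infty_natSinv_lt (PosNum d0).
exists k => s r.
rewrite -[X in X - _]mulr1 -(psi_sum k r) mulr_sumr -sumrB.
rewrite (le_trans (ler_norm_sum _ _ _))//.
rewrite -[leRHS]mulr1 -(psi_sum k r) mulr_sumr; apply: ler_sum => i _.
have [->|p0] := eqVneq (psi k i r) 0; first by rewrite !mulr0 subrr normr0.
have /andP[pge0 _] := psi01 k i r.
rewrite -mulrBl normrM (ger0_norm pge0) ler_wpM2r// ltW//.
by apply: dP; rewrite (lt_trans _ kd)// psi_supp.
Unshelve. all: by end_near. Qed.

(** The functions [psi k i] supported in [U] are summed over [k < m]. The sum vanishes off [U],
    increases with [m], and at each point of [U] is eventually bounded away from [0]; multiplied by
    [m] and truncated at [1] it reaches the indicator. *)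
Lemma open_indic_approx : open_indic_approximable R S.
Proof.
move=> U oU.
pose sub k i := `[< forall r, psi k i r != 0 -> U r >].
pose s m r := \sum_(k < m) \sum_(i < n k | sub k i) psi k i r.
have s_homo r : {homo s ^~ r : p q / (p <= q)%N >-> p <= q}.
  apply: homo_leq => [||p]; [exact: lexx|exact: le_trans|].
  rewrite /s big_ord_recr/= lerDl sumr_ge0// => i _.
  by have /andP[] := psi01 p i r.
have s_ge0 m r : 0 <= s m r.
  by rewrite /s sumr_ge0// => k _; rewrite sumr_ge0// => i _; have /andP[] := psi01 k i r.
exists (fun m r => Num.min 1 (m%:R * s m r)); split.
- move=> m; apply: continuousf_min; first exact: continuousf_cst.
  apply: continuousfM; first exact: continuousf_cst.
  apply: continuousf_sum => k; exact: continuousf_sum.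
- move=> m r; rewrite le_min ler01 ge_min lexx/= andbT.
  by rewrite mulr_ge0.
- move=> r p q pq; rewrite le_min ge_min lexx/= ge_min; apply/orP; right.
  by rewrite ler_pM// ?ler_nat// s_homo.
- move=> m r Ur; rewrite (_ : s m r = 0) ?mulr0 ?min_r//.
  rewrite /s big1// => k _; rewrite big1// => i /asboolP subi.
  by apply/eqP; apply: contrapT => /negP /subi.
move=> r Ur; have [d d0 dP] := cost_nbhs_basis oU Ur.
have [k _ /(_ _ (leqnn k)) kd] : \forall k \near \oo, k.+1%:R^-1 < d :> R.
  by near=> k; near: k; exact: near_infty_natSinv_lt (PosNum d0).
have [i pi] : exists i : 'I_(n k), psi k i r != 0.
  apply: contrapT => /forallNP H; have := psi_sum k r.
  rewrite big1 ?(eq_sym 0)//; first by move/eqP; rewrite eq_sym oner_eq0.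
  by move=> i _; apply/eqP; apply: contrapT => /negP; exact: H.
(* Both [r] and any other point of the support of [psi k i] have cost less than [d] from the node
   [x k i], so the choice of [d] puts the whole support in [U]. *)
have subi : sub k i.
  apply/asboolP => r' pr'; apply: (dP (x k i)); rewrite (lt_trans _ kd)//; exact: psi_supp.
have pi0 : 0 < psi k i r by rewrite lt_neqAle eq_sym pi/=; have /andP[] := psi01 k i r.
near=> m.
apply/min_idPl; have km : (k < m)%N by near: m; exact: nbhs_infty_gt.
apply: (@le_trans _ _ (m%:R * psi k i r)).
  rewrite -ler_pdivrMr// mul1r.
  by near: m; exact: nbhs_infty_ger.
rewrite ler_wpM2l// /s (bigD1 (Ordinal km))//= (bigD1 i)//= -addrA lerDl.
rewrite addr_ge0// sumr_ge0// => j _; first by have /andP[] := psi01 k j r.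
by rewrite sumr_ge0// => l _; have /andP[] := psi01 j l r.
Unshelve. all: by end_near. Qed.

End approximation.

End separating_cost.

(** * Bounded measurable functions and their integrals *)

Section bounded_measurable_functions.
Context d {T : measurableType d} {R : realType}.
Implicit Types (f g : T -> R) (P : probability T R).

(** A condition independent of the measure that yields integrability against every probability, in
    particular against all the [p s] of a kernel at once. *)
Definition bounded_measurable f :=
  measurable_fun [set: T] f /\ exists M, forall x, `|f x| <= M.

Lemma bounded_measurable_cst (r : R) : bounded_measurable (fun=> r).
Proof. by split; [exact: measurable_cst|exists `|r|]. Qed.

Lemma bounded_measurableD f g : bounded_measurable f -> bounded_measurable g ->
  bounded_measurable (fun x => f x + g x).
Proof.
move=> [mf [M fM]] [mg [N gN]]; split; first exact: measurable_funD.
by exists (M + N) => x; rewrite (le_trans (ler_normD _ _))// lerD.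
Qed.

Lemma bounded_measurableM f g : bounded_measurable f -> bounded_measurable g ->
  bounded_measurable (fun x => f x * g x).
Proof.
move=> [mf [M fM]] [mg [N gN]]; split; first exact: measurable_funM.
by exists (M * N) => x; rewrite normrM ler_pM.
Qed.

Lemma bounded_measurable_sum (I : Type) (s : seq I) (Q : pred I) (F : I -> T -> R) :
  (forall i, bounded_measurable (F i)) ->
  bounded_measurable (fun x => \sum_(i <- s | Q i) F i x).
Proof.
move=> bF; elim: s => [|i s IH].
  by under eq_fun do rewrite big_nil; exact: bounded_measurable_cst.
under eq_fun do rewrite big_cons.
by case: (Q i) => //; exact: bounded_measurableD.
Qed.

Lemma bounded_measurable_integrable P f : bounded_measurable f ->
  P.-integrable [set: T] (EFin \o f).
Proof.
move=> [mf [M fM]]; apply: measurable_bounded_integrable => //.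
  by rewrite [X in (X < _)%E](probability_setT P) ltry.
exists M; split; first exact: num_real.
by move=> N MN x _; exact: (le_trans (fM x) (ltW MN)).
Qed.

Lemma EFin_Rintegral P f : bounded_measurable f ->
  (\int[P]_x f x)%:E = (\int[P]_x (f x)%:E)%E.
Proof.
move=> bf; rewrite fineK//; apply: integrable_fin_num => //.
exact: bounded_measurable_integrable.
Qed.

Lemma Rintegral_probD P f g : bounded_measurable f -> bounded_measurable g ->
  \int[P]_x (f x + g x) = \int[P]_x f x + \int[P]_x g x.
Proof. by move=> bf bg; rewrite RintegralD//; exact: bounded_measurable_integrable. Qed.

Lemma Rintegral_probZ P (r : R) f : bounded_measurable f ->
  \int[P]_x (r * f x) = r * \int[P]_x f x.
Proof. by move=> bf; rewrite RintegralZl//; exact: bounded_measurable_integrable. Qed.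

Lemma Rintegral_prob_cst P (r : R) : \int[P]_x r = r.
Proof. by rewrite Rintegral_cst// [X in fine X](probability_setT P) mulr1. Qed.

Lemma Rintegral_probB P f g : bounded_measurable f -> bounded_measurable g ->
  \int[P]_x (f x - g x) = \int[P]_x f x - \int[P]_x g x.
Proof. by move=> bf bg; rewrite RintegralB//; exact: bounded_measurable_integrable. Qed.

Lemma Rintegral_prob_sum P (I : Type) (s : seq I) (Q : pred I) (F : I -> T -> R) :
  (forall i, bounded_measurable (F i)) ->
  \int[P]_x (\sum_(i <- s | Q i) F i x) = \sum_(i <- s | Q i) \int[P]_x F i x.
Proof.
move=> bF; elim: s => [|i s IH].
  by under eq_Rintegral do rewrite big_nil; rewrite Rintegral_prob_cst big_nil.
rewrite big_cons -IH; under eq_Rintegral do rewrite big_cons.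
by case: (Q i) => //; rewrite Rintegral_probD//; exact: bounded_measurable_sum.
Qed.

Lemma le_Rintegral_prob P f g : bounded_measurable f -> bounded_measurable g ->
  (forall x, f x <= g x) -> \int[P]_x f x <= \int[P]_x g x.
Proof.
by move=> bf bg fg; apply: le_Rintegral => //; exact: bounded_measurable_integrable.
Qed.

Lemma Rintegral_prob_dist P f g (e : R) :
  bounded_measurable f -> bounded_measurable g ->
  (forall x, `|f x - g x| <= e) ->
  `|\int[P]_x f x - \int[P]_x g x| <= e.
Proof.
move=> bf bg fg; rewrite ler_distl -(Rintegral_prob_cst P e).
have be := bounded_measurable_cst e.
rewrite -Rintegral_probB// -Rintegral_probD//.
apply/andP; split; apply: le_Rintegral_prob => //.
- by apply: bounded_measurableD => //; have := bounded_measurableM (bounded_measurable_cst (-1)) be;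
    under eq_fun do rewrite mulN1r.
- by move=> x; have := fg x; rewrite ler_distl => /andP[].
- exact: bounded_measurableD.
- by move=> x; have := fg x; rewrite ler_distl => /andP[].
Qed.

End bounded_measurable_functions.

Lemma borel_continuous_measurable {R : realType} {S : ptopologicalType}
    (f : S -> R) : continuous f -> measurable_fun [set: borel S] f.
Proof.
move=> cf; apply: (measurability _ (RGenOpens.measurableE R)) => _ [_ [a [b ->]] <-].
rewrite setTI; apply: sub_sigma_algebra.
by apply: open_comp => [x _|]; [exact: cf|exact: interval_open].
Qed.

Lemma continuous_bounded_measurable {R : realType} {S : ptopologicalType}
    (f : S -> R) : compact [set: S] -> continuous f ->
  bounded_measurable (f : borel S -> R).
Proof.
move=> Sc cf; split; first exact: borel_continuous_measurable.
by have [M _ fM] := compact_bounded Sc cf; exists M.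
Qed.

(** The enumeration [b] is chosen before [a]: a double family of functions merged along [b] has its
    pointwise series and its series of [L]-values rearranged by the same [b]. *)
Lemma nneseries_pair (R : realType) : exists b : nat -> nat * nat,
  forall a : nat * nat -> \bar R, (forall ij, 0 <= a ij)%E ->
  (\sum_(k <oo) a (b k) = \sum_(i <oo) \sum_(j <oo) a (i, j))%E.
Proof.
have /card_esym/ppcard_eqP[b] := card_nat2.
exists b => a a0.
transitivity (\esum_(ij in [set: nat * nat]) a ij)%E.
  by rewrite -(esum_pred_image a _ xpredT) ?[fun=> _]set_true ?image_eq.
pose J : nat -> set (nat * nat) := fun i => [set (i, j) | j in setT].
rewrite (_ : setT = \bigcup_k J k); last first.
  by rewrite predeqE => -[i j]; split => // _; exists i => //; exists j.
rewrite esum_bigcupT//=; last first.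
  apply/trivIsetP => i j _ _ ij.
  rewrite predeqE => -[n m] /=; split => //= -[] [_] _ [<-{n} _].
  by move=> [m' _] [] /esym/eqP; rewrite (negbTE ij).
rewrite -(image_id [set: nat]) -fun_true esum_pred_image//; last first.
  by move=> n _; exact: esum_ge0.
apply: eq_eseriesr => /= j _.
rewrite -(esum_pred_image a (pair j) predT)//=; last first.
  by move=> ? ? _ _; exact: (@can_inj _ _ _ snd).
by congr esum; rewrite predeqE => -[p q]; split; move=> [i _ <-]; exists i.
Qed.

(** * The Riesz representation theorem on a compact space *)

Section riesz_representation.
Context {R : realType} {S : ptopologicalType}.
Hypothesis S_compact : compact [set: S].
Hypothesis open_approx : open_indic_approximable R S.

Variable L : (S -> R) -> R.
Hypothesis L_add : forall f g : S -> R, continuous f -> continuous g ->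
  L (fun x => f x + g x) = L f + L g.
Hypothesis L_scale : forall (a : R) (f : S -> R), continuous f -> L (fun x => a * f x) = a * L f.
Hypothesis L_ge0 : forall f : S -> R, continuous f -> (forall x, 0 <= f x) -> 0 <= L f.
Hypothesis L_one : L (fun=> 1) = 1.

Let L_sub (f g : S -> R) : continuous f -> continuous g ->
  L (fun x => f x - g x) = L f - L g.
Proof.
move=> cf cg; rewrite -[- L g]mulN1r -L_scale// -L_add//.
  by congr L; apply/funext => x; rewrite mulN1r.
by apply: continuousfM => //; exact: continuousf_cst.
Qed.

Let L_le (f g : S -> R) : continuous f -> continuous g -> (forall x, f x <= g x) ->
  L f <= L g.
Proof.
move=> cf cg fg; rewrite -subr_ge0 -L_sub//; apply: L_ge0.
  exact: continuousfB.
by move=> x; rewrite subr_ge0.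
Qed.

Let L_cst (a : R) : L (fun=> a) = a.
Proof.
rewrite -[RHS]mulr1 -L_one -L_scale; last exact: continuousf_cst.
by under [in RHS]eq_fun do rewrite mulr1.
Qed.

Let L_sum (I : Type) (s : seq I) (F : I -> S -> R) :
  (forall i, continuous (F i)) ->
  L (fun x => \sum_(i <- s) F i x) = \sum_(i <- s) L (F i).
Proof.
move=> cF; elim: s => [|i s IH].
  by under eq_fun do rewrite big_nil; rewrite L_cst big_nil.
under eq_fun do rewrite big_cons.
by rewrite big_cons -IH L_add//; exact: continuousf_sum.
Qed.

Local Open Scope ereal_scope.

Definition function_cover (A : set S) : set (nat -> S -> R) :=
  [set f : nat -> S -> R | [/\ forall k, continuous (f k), forall k x, (0 <= f k x)%R &
    forall x, A x -> 1 <= \sum_(k <oo) (f k x)%:E]].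

(** Daniell's construction: the upper integral of the indicator of [A], with countable sums of
    non-negative continuous functions as upper functions. *)
Definition riesz_outer (A : set S) : \bar R :=
  ereal_inf [set \sum_(k <oo) (L (f k))%:E | f in function_cover A].

Let L_fin_ge0 (A : set S) f : function_cover A f -> forall k, 0 <= (L (f k))%:E.
Proof. by move=> [cf f0 _] k; rewrite lee_fin L_ge0. Qed.

Let riesz_outer_ge0 A : 0 <= riesz_outer A.
Proof.
by apply: le_ereal_inf_tmp => _ [f fA <-]; apply: nneseries_ge0 => k _ _; exact: L_fin_ge0 fA k.
Qed.

Let riesz_outer0 : riesz_outer set0 = 0.
Proof.
apply/eqP; rewrite eq_le riesz_outer_ge0 andbT.
apply: ereal_inf_lbound; exists (fun _ _ => 0%R).
  by split => // k; exact: continuousf_cst.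
by rewrite eseries0// => k _ _; rewrite L_cst.
Qed.

Let riesz_outer_homo : {homo riesz_outer : A B / A `<=` B >-> A <= B}.
Proof.
move=> A B AB; apply/ereal_inf_le_tmp => _ [f [cf f0 fB] <-].
by exists f => //; split => // x /AB; exact: fB.
Qed.

Let riesz_outer_le1 (A : set S) (f : S -> R) : continuous f -> (forall x, 0 <= f x)%R ->
  (forall x, A x -> 1 <= f x)%R -> riesz_outer A <= (L f)%:E.
Proof.
move=> cf f0 fA.
pose F k x : R := if k is 0%N then f x else 0%R.
have cF k : continuous (F k) by case: k => // k; exact: continuousf_cst.
have series1 (u : nat -> \bar R) : (forall k, u k.+1 = 0) -> \sum_(k <oo) u k = u 0%N.
  move=> u0; apply: lim_near_cst => //; near=> n.
  have : (0 < n)%N by near: n; exact: nbhs_infty_gt.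
  by move=> n0; rewrite -(prednK n0) big_nat_recl// big1 ?adde0.
apply: ereal_inf_lbound; exists F.
  split => // [k x|x Ax]; first by case: k => /=.
  by rewrite series1//= lee_fin fA.
by rewrite series1// => k; rewrite L_cst.
Unshelve. all: by end_near. Qed.

Let riesz_outer_sigma_subadditive : sigma_subadditive riesz_outer.
Proof.
move=> A; have [[i ioo]|] := pselect (exists i, riesz_outer (A i) = +oo).
  rewrite (eseries_pinfty _ _ ioo) ?leey// => n _.
  by rewrite -ltNye (lt_le_trans _ (riesz_outer_ge0 _)).
rewrite -forallNE => Aoo.
apply/lee_addgt0Pr => e e0.
rewrite (le_trans _ (epsilon_trick _ _ _))//; last exact: ltW.
(* A cover of each [A n] that is optimal up to [e / 2^(n+1)]; along [b] these merge into one cover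
   of the union. *)
have /choice[G PG] : forall n, exists f, function_cover (A n) f /\
    \sum_(k <oo) (L (f k))%:E <= riesz_outer (A n) + (e / (2 ^ n.+1)%:R)%:E.
  move=> n; have en : (0 < e / (2 ^ n.+1)%:R)%R by rewrite divr_gt0// ltr0n expn_gt0.
  have /(lb_ereal_inf_adherent en) : riesz_outer (A n) \is a fin_num.
    by rewrite ge0_fin_numE// ltey; apply/eqP; exact: Aoo.
  by move=> [_ [f fA <-] /ltW fe]; exists f.
have [b bP] := nneseries_pair R.
apply: (@le_trans _ _ (\sum_(i <oo) \sum_(j <oo) (L (G i j))%:E)); last first.
  apply: lee_nneseries => [i _ _|i _]; last exact: (PG i).2.
  by apply: nneseries_ge0 => j _ _; exact: L_fin_ge0 (PG i).1 j.
rewrite -(bP (fun ij => (L (G ij.1 ij.2))%:E)); last first.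
  by move=> [i j]; exact: L_fin_ge0 (PG i).1 j.
apply: ereal_inf_lbound; exists (fun k => G (b k).1 (b k).2) => //.
split.
- by move=> k; case: (PG (b k).1).1.
- by move=> k; case: (PG (b k).1).1.
move=> x [i _ Aix].
rewrite (bP (fun ij => (G ij.1 ij.2 x)%:E)); last first.
  by move=> [p q]; rewrite lee_fin; case: (PG p).1.
have [_ _ /(_ x Aix) Gi] := (PG i).1.
rewrite (le_trans Gi)//.
have G0 p : 0 <= \sum_(j <oo) (G p j x)%:E.
  by apply: nneseries_ge0 => q _ _; rewrite lee_fin; case: (PG p).1.
apply: (le_trans _ (@nneseries_lim_ge _ _ xpredT 0 i.+1 _)) => //=.
by rewrite big_nat_recr//= leeDr// sume_ge0.
Qed.

HB.instance Definition _ := isOuterMeasure.Build R S riesz_outer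
  riesz_outer0 riesz_outer_ge0 riesz_outer_homo riesz_outer_sigma_subadditive.

(* A cover [F] of [X] splits along the partition of unity
   [g_M + (1 - g_M) = 1], where [g_M] increases to the indicator of [U]. *)
Let open_caratheodory (U : set S) : open U -> riesz_outer.-caratheodory U.
Proof.
move=> oU; have [g [cg g01 g_homo gU0 gU1]] := open_approx oU.
apply: le_caratheodory_measurable => X.
apply: le_ereal_inf_tmp => _ [F FX <-].
have [cF F0 F1] := FX.
(* [g'] is [g] delayed by one with [g' 0 = 0], so that the increments [h m] of [g] telescope: those
   below [M] sum to [g' M]. *)
pose g' m x : R := if m is m'.+1 then g m' x else 0%R.
have cg' m : continuous (g' m) by case: m => [|m]; [exact: continuousf_cst|exact: cg].
have g'01 m x : (0 <= g' m x <= 1)%R by case: m => [|m] /=; rewrite ?lexx ?ler01 ?g01.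
pose h m x := (g m x - g' m x)%R.
have ch m : continuous (h m) by exact: continuousfB.
have h0 m x : (0 <= h m x)%R.
  rewrite /h subr_ge0; case: m => [|m] /=; first by have /andP[] := g01 0%N x.
  exact: g_homo.
have sumh M x : (\sum_(m < M) h m x = g' M x)%R.
  elim: M => [|M IH]; first by rewrite big_ord0.
  by rewrite big_ord_recr/= IH /h addrC subrK.
have cFh m k : continuous (fun x => F k x * h m x)%R by exact: continuousfM.
have Fh0 m k x : (0 <= F k x * h m x)%R by rewrite mulr_ge0.
have LFh0 m k : 0 <= (L (fun x => F k x * h m x)%R)%:E by rewrite lee_fin L_ge0.
have [b bP] := nneseries_pair R.
have XU : riesz_outer (X `&` U) <=
    \sum_(m <oo) \sum_(k <oo) (L (fun x => F k x * h m x)%R)%:E.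
  rewrite -(bP (fun ij => (L (fun x => F ij.2 x * h ij.1 x)%R)%:E))//.
  apply: ereal_inf_lbound; exists (fun k x => F (b k).2 x * h (b k).1 x)%R => //.
  split => // x [Xx Ux].
  rewrite (bP (fun ij => (F ij.2 x * h ij.1 x)%:E)); last by move=> ij; rewrite lee_fin.
  have [M _ /(_ M (leqnn M)) gM] := gU1 _ Ux.
  apply: (@le_trans _ _ (\sum_(0 <= m < M.+1) (h m x)%:E)).
    by rewrite sumEFin lee_fin big_mkord sumh /= gM.
  apply: le_trans (nneseries_lim_ge M.+1 _); last first.
    by move=> m _ _; apply: nneseries_ge0 => k _ _; rewrite lee_fin.
  apply: lee_sum => m _.
  rewrite (_ : \sum_(k <oo) _ = (h m x)%:E * \sum_(k <oo) (F k x)%:E); last first.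
    rewrite -nneseriesZl; last by move=> k _; rewrite lee_fin.
    by apply: eq_eseriesr => k _; rewrite mulrC EFinM.
  by rewrite -[leLHS]mule1; apply: lee_pmul => //; [rewrite lee_fin|exact: F1].
have cF1g M k : continuous (fun x => F k x * (1 - g' M x))%R.
  by apply: continuousfM => //; apply: continuousfB => //; exact: continuousf_cst.
have F1g0 M k x : (0 <= F k x * (1 - g' M x))%R.
  by rewrite mulr_ge0// subr_ge0; case/andP: (g'01 M x).
have XnU M : riesz_outer (X `&` ~` U) <=
    \sum_(k <oo) (L (fun x => F k x * (1 - g' M x))%R)%:E.
  apply: ereal_inf_lbound; exists (fun k x => F k x * (1 - g' M x))%R => //.
  split => // x [Xx Ux].
  have g'0 : g' M x = 0%R by case: (M) => //= m; exact: gU0.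
  rewrite (_ : \sum_(k <oo) _ = \sum_(k <oo) (F k x)%:E); first exact: F1.
  by apply: eq_eseriesr => k _; rewrite g'0 subr0 mulr1.
apply: (le_trans (leeD2r _ XU)).
(* The infinite case is set apart because a finite term is subtracted below. As [g' 0 = 0], the
   bound [XnU] at stage [0] is the total of the cover [F], which is then infinite. *)
have [oo|noo] := eqVneq (riesz_outer (X `&` ~` U)) +oo.
  have := XnU 0%N; rewrite oo leye_eq => /eqP XnU0.
  rewrite (_ : \sum_(k <oo) (L (F k))%:E = +oo) ?leey// -XnU0.
  apply: eq_eseriesr => k _; congr (L _)%:E; apply/funext => x.
  by rewrite /= subr0 mulr1.
have XnU_fin : riesz_outer (X `&` ~` U) \is a fin_num.
  by rewrite ge0_fin_numE// ltey.
(* Partial sums suffice: the part of [F k] weighted by the first [M] increments has weight [g' M],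
   the cover of the complement has weight [1 - g' M], and additivity of [L] restores [L (F k)]. *)
rewrite -leeBrDr//; apply: lime_le.
  by apply: is_cvg_nneseries => m _ _; apply: nneseries_ge0.
apply: nearW => M; rewrite leeBrDr//.
apply: (le_trans (leeD2l _ (XnU M))).
have -> : \sum_(0 <= m < M) \sum_(k <oo) (L (fun x => F k x * h m x)%R)%:E =
    \sum_(k <oo) (L (fun x => F k x * g' M x)%R)%:E.
  rewrite -nneseries_sum_nat//; apply: eq_eseriesr => k _.
  rewrite sumEFin -L_sum//; congr (_%:E); congr L; apply/funext => x.
  by rewrite -mulr_sumr big_mkord sumh.
rewrite -nneseriesD; last 2 first.
- move=> k _ _; rewrite lee_fin L_ge0//; first exact: continuousfM.
  by move=> x; rewrite mulr_ge0//; case/andP: (g'01 M x).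
- by move=> k _ _; rewrite lee_fin L_ge0.
apply: lee_nneseries => [k _ _|k _].
  rewrite adde_ge0// lee_fin L_ge0//; first exact: continuousfM.
  by move=> x; rewrite mulr_ge0//; case/andP: (g'01 M x).
rewrite -EFinD -L_add//; last exact: continuousfM.
rewrite lee_fin (_ : (fun x => _) = F k)//; apply/funext => x.
by rewrite -mulrDr addrC subrK mulr1.
Qed.

Let borel_caratheodory (A : set (borel S)) : measurable A ->
  riesz_outer.-cara.-measurable A.
Proof.
apply: smallest_sub; last exact: open_caratheodory.
split; first exact: (@measurable0 _ (caratheodory_type riesz_outer)).
- by move=> B mB; rewrite setTD; exact: (@measurableC _ (caratheodory_type riesz_outer)).
- by move=> F mF; exact: (@bigcupT_measurable _ (caratheodory_type riesz_outer)).
Qed.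

Definition riesz_measure (A : set (borel S)) : \bar R := riesz_outer A.

Let riesz_measure_sigma_additive : semi_sigma_additive riesz_measure.
Proof.
move=> F mF tF mUF; apply: caratheodory_measure_sigma_additive => //.
- by move=> i; exact: borel_caratheodory.
- exact: borel_caratheodory.
Qed.

HB.instance Definition _ := isMeasure.Build _ _ _ riesz_measure
  riesz_outer0 riesz_outer_ge0 riesz_measure_sigma_additive.

(** The constant [1] is a cover of mass [1]. Conversely, by compactness finitely many functions of
    any cover sum to at least [1 - e] everywhere, and positivity of [L] transfers this bound to
    their [L]-values. *)
Let riesz_measure_setT : riesz_measure setT = 1.
Proof.
apply/eqP; rewrite eq_le; apply/andP; split.
  by rewrite -L_one; apply: riesz_outer_le1 => //; exact: continuousf_cst.
apply: le_ereal_inf_tmp => _ [F [cF F0 F1] <-].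
apply/lee_addgt0Pr => e e0.
have := S_compact; rewrite compact_cover.
move=> /(_ _ setT (fun n => [set x | 1 - e < \sum_(k < n) F k x]%R)) [||D _ DT].
- by move=> n _; apply: open_gt; exact: continuousf_sum.
- move=> x _.
  have : (1 - e)%:E < \sum_(k <oo) (F k x)%:E.
    by rewrite (lt_le_trans _ (F1 x I))// lte_fin ltrBlDr ltrDl.
  rewrite (cvg_lim _ (ereal_nondecreasing_cvgn _))//; last first.
    by apply: ereal_nondecreasing_series => k _ _; rewrite lee_fin.
  move=> /ereal_sup_gt[_ [n _ <-]].
  by rewrite sumEFin lte_fin big_mkord => ?; exists n.
pose N := \max_(i <- finmap.enum_fset D) i.
have FN x : (1 - e <= \sum_(k < N) F k x)%R.
  have [n /= nD /ltW/le_trans] := DT x I; apply.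
  have nN : (n <= N)%N by exact: leq_bigmax_seq.
  rewrite (big_ord_widen _ (fun k => F k x) nN) big_mkcond/=.
  by apply: ler_sum => i _; case: ifP.
rewrite -leeBlDr//; apply: le_trans (nneseries_lim_ge N _); last first.
  by move=> k _ _; rewrite lee_fin L_ge0.
rewrite sumEFin -EFinB lee_fin -[leLHS]L_cst -L_sum//.
apply: L_le; [exact: continuousf_cst|exact: continuousf_sum|].
by move=> x; rewrite big_mkord.
Qed.

HB.instance Definition _ :=
  Measure_isProbability.Build _ _ _ riesz_measure riesz_measure_setT.

Local Close Scope ereal_scope.

Let P : probability (borel S) R := riesz_measure.

(** Layer cake: [f] is cut into slices [F j] of height [1/(n+1)]. On [A], where [f >= t j.+1], slice
    [j] is full, whereas slice [j.+1] vanishes outside [A]; hence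
    [int F j.+1 <= P A / (n+1) <= L (F j)]. *)
Let riesz_le01 (f : S -> R) : continuous f -> (forall x, 0 <= f x <= 1) ->
  \int[P]_x f x <= L f.
Proof.
move=> cf f01; apply/ler_addgt0Pr => e e0.
have [n _ /(_ n (leqnn n)) ne] : \forall n \near \oo, n.+1%:R^-1 < e :> R.
  by near=> n; near: n; exact: near_infty_natSinv_lt (PosNum e0).
pose t j : R := j%:R / n.+1%:R.
pose F j x := Num.min (f x) (t j.+1) - Num.min (f x) (t j).
have tS j : t j.+1 = t j + n.+1%:R^-1.
  by rewrite /t -[in LHS]addn1 natrD mulrDl mul1r.
have n0 : 0 < n.+1%:R^-1 :> R by rewrite invr_gt0.
have cF j : continuous (F j).
  by apply: continuousfB; apply: continuousf_min => //; exact: continuousf_cst.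
have F0 j x : 0 <= F j x.
  by rewrite subr_ge0 le_min !ge_min lexx tS/= lerDl (ltW n0) orbT.
have FE x : \sum_(j < n.+1) F j x = f x.
  have H m : \sum_(j < m) F j x = Num.min (f x) (t m).
    elim: m => [|m IH]; last by rewrite big_ord_recr/= IH addrC subrK.
    by rewrite big_ord0 /t mul0r; apply/esym/min_idPr; case/andP: (f01 x).
  rewrite H /t divff ?pnatr_eq0//; apply/min_idPl.
  by case/andP: (f01 x).
have bF j : bounded_measurable (F j : borel S -> R).
  exact: continuous_bounded_measurable.
have Fle j x : F j x <= n.+1%:R^-1.
  move: n0; rewrite /F tS; move: (_^-1) => u u0.
  by have [? | ?] := leP (f x) (t j + u); have [? | ?] := leP (f x) (t j); lra.
have intF j : \int[P]_x F j.+1 x <= L (F j).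
  pose A : set (borel S) := [set x | t j.+1 <= f x].
  have mA : measurable A.
    by rewrite -[A]setCK; apply: measurableC; apply: sub_sigma_algebra;
      apply: closed_openC; exact: closed_ge.
  have PA : (P A <= (n.+1%:R * L (F j))%:E)%E.
    rewrite -L_scale//; apply: riesz_outer_le1.
    - by apply: continuousfM => //; exact: continuousf_cst.
    - by move=> x; rewrite mulr_ge0.
    - move=> x Ax; rewrite /F !min_r//; last by rewrite (le_trans _ Ax)// tS lerDl ltW.
      by rewrite tS addrAC subrr add0r divff ?pnatr_eq0.
  rewrite -lee_fin EFin_Rintegral//.
  apply: (@le_trans _ _ (\int[P]_x (n.+1%:R^-1 * \1_A x)%:E)%E).
    apply: ge0_le_integral => //.
    - by move=> x _; rewrite lee_fin.
    - by apply/measurable_EFinP; exact: (bF _).1.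
    - by apply/measurable_EFinP; apply: measurable_funM => //.
    - move=> x _; rewrite lee_fin indicE; have [xA|xA] := boolP (x \in A).
        by rewrite mulr1.
      rewrite mulr0 /F subr_le0 le_min !ge_min lexx/=.
      have : f x < t j.+1 by rewrite ltNge; apply: contra xA; rewrite inE.
      by move=> /ltW ->.
  under eq_integral do rewrite EFinM.
  rewrite ge0_integralZl//; last exact/measurable_EFinP.
  rewrite integral_indic// setIT.
  apply: (le_trans (lee_wpmul2l _ PA)); first by rewrite lee_fin ltW.
  by rewrite -EFinM mulrA mulVf ?pnatr_eq0// mul1r.
have -> : \int[P]_x f x = \sum_(j < n.+1) \int[P]_x F j x.
  rewrite -Rintegral_prob_sum//.
  by apply: eq_Rintegral => x _; rewrite FE.
(* The slices are compared with a shift by one: slice [0] has integral at most [1/(n+1) < e], and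
   the unmatched [F n] is dropped since it is non-negative. *)
rewrite big_ord_recl/= addrC lerD//; last first.
  rewrite (le_trans _ (ltW ne))// -[leRHS](Rintegral_prob_cst P).
  by apply: le_Rintegral_prob => //; exact: bounded_measurable_cst.
apply: (@le_trans _ _ (\sum_(j < n) L (F j))).
  by apply: ler_sum => j _; exact: intF.
rewrite -L_sum//; apply: L_le => // [|x]; first exact: continuousf_sum.
by rewrite -FE big_ord_recr/= lerDl.
Unshelve. all: by end_near. Qed.

Let riesz_le (f : S -> R) : continuous f -> \int[P]_x f x <= L f.
Proof.
move=> cf; have [M M0 fM] := compact_bounded S_compact cf.
have M10 : 0 < M + 1 by rewrite ltr_wpDl.
(* This affine change brings [f] into [[0, 1]]; [M + 1] keeps the divisor positive when [M = 0]. *)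
pose a := (2 * (M + 1))^-1; pose g x := a * f x + 2^-1.
have a0 : 0 < a by rewrite invr_gt0 mulr_gt0.
have caf : continuous (fun x => a * f x).
  by apply: continuousfM => //; exact: continuousf_cst.
have c2 := @continuousf_cst R S 2^-1.
have ac x : `|a * f x| <= 2^-1.
  rewrite normrM (gtr0_norm a0) /a invfM -mulrA ger_pMr ?invr_gt0//.
  by rewrite mulrC ler_pdivrMr// mul1r (le_trans (fM x))// lerDl.
have cg : continuous g by exact: continuousfD.
have /riesz_le01 := cg; rewrite /g L_add// L_cst L_scale//.
rewrite Rintegral_probD ?Rintegral_prob_cst//; last 2 first.
- exact: continuous_bounded_measurable.
- exact: bounded_measurable_cst.
rewrite Rintegral_probZ; last exact: continuous_bounded_measurable.
rewrite lerD2r ler_pM2l//; apply => x.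
by have := ac x; rewrite ler_norml => /andP[? ?]; apply/andP; split; lra.
Qed.

(** The inequality [riesz_le] for [f] and for [-f] gives equality. *)
Theorem riesz_representation : exists Q : probability (borel S) R,
  forall f : S -> R, continuous f -> \int[Q]_x f x = L f.
Proof.
exists P => f cf; apply/eqP; rewrite eq_le riesz_le//=.
have cNf : continuous (fun x => -1 * f x).
  by apply: continuousfM => //; exact: continuousf_cst.
have := riesz_le cNf; rewrite L_scale// Rintegral_probZ; last first.
  exact: continuous_bounded_measurable.
by rewrite !mulN1r lerN2.
Qed.

End riesz_representation.

(** * Mixtures of two probabilities *)

Section mixtures.
Context d {T : measurableType d} {R : realType}.
Implicit Types P Q : probability T R.

Lemma onem_ge0_itv (t : R) : 0 <= t <= 1 -> 0 <= 1 - t.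
Proof. by rewrite subr_ge0 => /andP[]. Qed.

(** Built from [measure_add] and [mscale], which carry measure structures, so that only the total
    mass remains to be checked. *)
Definition mixture P Q (t : R) (t01 : 0 <= t <= 1) : set T -> \bar R :=
  measure_add (mscale (NngNum (andP t01).1) P)
              (mscale (NngNum (onem_ge0_itv t01)) Q).

HB.instance Definition _ P Q (t : R) (t01 : 0 <= t <= 1) :=
  Measure.on (mixture P Q t01).

Lemma mixtureE P Q (t : R) (t01 : 0 <= t <= 1) A :
  mixture P Q t01 A = (t%:E * P A + (1 - t)%:E * Q A)%E.
Proof. by rewrite /mixture measure_addE. Qed.

Let mixture_setT P Q (t : R) (t01 : 0 <= t <= 1) : mixture P Q t01 setT = 1%E.
Proof. by rewrite mixtureE !probability_setT !mule1 -EFinD addrC subrK. Qed.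

HB.instance Definition _ P Q (t : R) (t01 : 0 <= t <= 1) :=
  Measure_isProbability.Build _ _ _ (mixture P Q t01) (mixture_setT P Q t01).

Lemma Rintegral_mixture P Q (t : R) (t01 : 0 <= t <= 1) (f : T -> R) :
  bounded_measurable f ->
  \int[mixture P Q t01]_x f x = t * \int[P]_x f x + (1 - t) * \int[Q]_x f x.
Proof.
move=> bf.
have mix_ge0 (g : T -> R) : measurable_fun setT g -> (forall x, 0 <= g x) ->
    (\int[mixture P Q t01]_x (g x)%:E =
     t%:E * \int[P]_x (g x)%:E + (1 - t)%:E * \int[Q]_x (g x)%:E)%E.
  move=> mg g0.
  have mEg : measurable_fun setT (EFin \o g) by exact/measurable_EFinP.
  rewrite [LHS](@ge0_integral_measure_add _ _ _
    (mscale (NngNum (andP t01).1) P) (mscale (NngNum (onem_ge0_itv t01)) Q))//; last by move=> x _; rewrite lee_fin.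
  by congr (_ + _)%E; rewrite ge0_integral_mscale// => x _; rewrite lee_fin.
have [mf [C fC]] := bf.
(* Adding the bound [C] reduces to a non-negative integrand; all three measures have mass [1], so
   the shift cancels. *)
have C0 x : 0 <= f x + C.
  by have := fC x; rewrite ler_norml => /andP[+ _]; rewrite -lerBlDr sub0r.
have bg : bounded_measurable (fun x => f x + C).
  by apply: bounded_measurableD => //; exact: bounded_measurable_cst.
have := mix_ge0 _ bg.1 C0; rewrite -!EFin_Rintegral// -!EFinM -EFinD => -[].
have bC := @bounded_measurable_cst _ T R C.
rewrite !Rintegral_probD// !Rintegral_prob_cst => H; lra.
Qed.

End mixtures.

(** * The completion of a Borel probability *)

Section completion.
Context {R : realType} {S : ptopologicalType}.
Variable mu : probability (borel S) R.

(** The measure used in [kernel_integral], named so that it can carry the structure of a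
    probability. *)
Definition completion : set (caratheodory_type (mu^*)%mu) -> \bar R :=
  @completed_measure_extension _ (borel S) R mu.

HB.instance Definition _ := Measure.on completion.

Let completion_setT : completion setT = 1%E.
Proof. exact: eq_trans (measurable_mu_extE mu measurableT) (probability_setT mu). Qed.

HB.instance Definition _ :=
  Measure_isProbability.Build _ _ _ completion completion_setT.

Lemma borel_measurable_completion (A : set S) :
  measurable (A : set (borel S)) ->
  measurable (A : set (caratheodory_type (mu^*)%mu)).
Proof. exact: caratheodory_measurable_mu_ext. Qed.

Lemma borel_measurable_fun_completion d (T : measurableType d) (f : S -> T) :
  measurable_fun [set: borel S] f ->
  measurable_fun [set: caratheodory_type (mu^*)%mu] f.
Proof.
by move=> mf _ Y mY; apply: borel_measurable_completion; exact: mf.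
Qed.

Lemma completion_negligible (A : set S) : mu.-negligible A ->
  completion.-negligible A.
Proof.
move=> [B [mB B0 AB]]; exists B; split => //; first exact: borel_measurable_completion.
exact: eq_trans (measurable_mu_extE mu mB) B0.
Qed.

(** A null set of the completion has outer measure [0], hence Borel supersets of measure at most
    [1/(n+1)] for every [n]; their intersection is a Borel null set. *)
Lemma negligible_completion (A : set S) : completion.-negligible A ->
  mu.-negligible A.
Proof.
move=> [B [mB B0 AB]].
have /choice[C CP] : forall n : nat, exists C : set (borel S),
    [/\ measurable C, B `<=` C & (mu C <= n.+1%:R^-1%:E)%E].
  move=> n; have n0 : 0 < n.+1%:R^-1 :> R by rewrite invr_gt0.
  have muB0 : (mu^* B)%mu = 0%E := B0.
  have finB : (mu^* B)%mu \is a fin_num by rewrite muB0.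
  have [_ [F [mF BF] <-]] := lb_ereal_inf_adherent n0 finB.
  rewrite -/(mu^* B)%mu muB0 add0e => /ltW Fn.
  exists (\bigcup_k F k); split => //; first exact: bigcupT_measurable.
  apply: le_trans Fn; apply: measure_sigma_subadditive => //.
  exact: bigcupT_measurable.
have mI : measurable (\bigcap_n C n) by apply: bigcapT_measurable => n; case: (CP n).
exists (\bigcap_n C n); split => //; last first.
  by move=> x /AB Bx n _; case: (CP n) => _ + _; exact.
apply/eqP; rewrite eq_le measure_ge0 andbT.
apply/lee_addgt0Pr => e e0; rewrite add0e.
have [n _ /(_ n (leqnn n)) ne] : \forall n \near \oo, n.+1%:R^-1 < e :> R.
  by near=> n; near: n; exact: near_infty_natSinv_lt (PosNum e0).
have [mC _ Cn] := CP n.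
apply: (@le_trans _ _ (mu (C n))).
  by apply: le_measure; rewrite ?inE//; exact: bigcap_inf.
by rewrite (le_trans Cn)// lee_fin ltW.
Unshelve. all: by end_near. Qed.

Lemma ae_completion (P : set S) :
  (\forall s \ae mu, P s) <-> (\forall s \ae completion, P s).
Proof.
split => H; first exact: (completion_negligible (A := ~` [set s | P s]) H).
exact: (negligible_completion (A := ~` [set s | P s]) H).
Qed.

Lemma completion_complete (A : set S) : completion.-negligible A ->
  measurable (A : set (caratheodory_type (mu^*)%mu)).
Proof. exact: measure_is_complete_caratheodory. Qed.

End completion.
Arguments completion {R S} mu _.

(** * Measurability of kernels through integrals of continuous functions *)

Section measurable_kernels.
Context {R : realType} {S : ptopologicalType}.
Hypothesis S_compact : compact [set: S].
Hypothesis open_approx : open_indic_approximable R S.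
Context d (X : measurableType d).
Implicit Type p : X -> probability (borel S) R.

Lemma measurable_kernel_integral p (f : S -> R) :
  measurable_fun [set: X] (p : X -> pprobability (borel S) R) ->
  continuous f -> bounded_measurable (fun s => \int[p s]_r f r).
Proof.
move=> mp cf; have bf := continuous_bounded_measurable S_compact cf.
have [mf [C fC]] := bf; split; last first.
  exists C => s; rewrite -[X in `|X|]subr0 -(Rintegral_prob_cst (p s) 0).
  apply: Rintegral_prob_dist => //; first exact: bounded_measurable_cst.
  by move=> x; rewrite subr0.
have C0 x : 0 <= f x + C.
  by have := fC x; rewrite ler_norml => /andP[+ _]; rewrite -lerBlDr sub0r.
have bC := @bounded_measurable_cst _ (borel S) R C.
have bfC := bounded_measurableD bf bC.
rewrite (_ : (fun s => _) = (fun s => \int[p s]_r (f r + C) - C)); last first.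
  by apply/funext => s; rewrite Rintegral_probD// Rintegral_prob_cst addrK.
apply: measurable_funB => //; apply/measurable_EFinP.
rewrite (_ : EFin \o _ = (fun s => \int[p s]_r (f r + C)%:E)%E); last first.
  by apply/funext => s; rewrite /= EFin_Rintegral.
apply: (@measurable_fun_integral_kernel _ _ X (borel S) R p).
- by move=> U mU; exact: (measurable_kernel (kprobability mp)).
- by move=> z; rewrite lee_fin; exact: C0.
- by apply/measurable_EFinP; exact: bfC.1.
Qed.

(** This is how mixtures and limits are seen to be kernels. Monotone convergence passes from
    continuous functions to open sets, which are stable under intersection, and Dynkin's theorem
    reaches all Borel sets. *)
Lemma kernel_integral_measurable p :
  (forall f : S -> R, continuous f ->
     measurable_fun [set: X] (fun s => \int[p s]_r f r)) ->
  measurable_fun [set: X] (p : X -> pprobability (borel S) R).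
Proof.
move=> mp.
suff H (A : set (borel S)) : measurable A -> measurable_fun [set: X] (fun s => p s A).
  apply: (measurability (@pset _ _ _ : set (set (pprobability (borel S) R)))) => //.
  move=> _ [_ [r r01] [A mA <-] <-]; rewrite setTI.
  by rewrite -[_ @^-1` _]setTI; exact: (emeasurable_fun_infty_o measurableT (H A mA) r%:E).
move: A; apply: dynkin_induction => //=.
- by move=> U V; exact: openI.
- by under eq_fun do rewrite probability_setT; exact: measurable_cst.
- move=> U oU; have [f [cf f01 f_homo fU0 fU1]] := open_approx oU.
  apply: (@emeasurable_fun_cvg _ _ R setT (fun m s => (\int[p s]_r f m r)%:E)).
    by move=> m; apply/measurable_EFinP; exact: mp.
  move=> s _.
  have mU : measurable (U : set (borel S)) by exact: sub_sigma_algebra.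
  have -> : p s U = (\int[p s]_r (\1_U r)%:E)%E by rewrite integral_indic// setIT.
  rewrite [X in X @ _ --> _](_ : _ = (fun m => \int[p s]_r (f m r)%:E)%E); last first.
    by apply/funext => m; rewrite EFin_Rintegral//;
      exact: (continuous_bounded_measurable S_compact (cf m)).
  have -> : (\int[p s]_r (\1_U r)%:E = \int[p s]_r (limn (fun m => (f m r)%:E)))%E.
    apply: eq_integral => r _; apply/esym/cvg_lim => //; apply/cvg_EFin.
      exact: nearW.
    rewrite indicE; have [rU|rU] := boolP (r \in U).
      by apply: cvg_near_cst; apply: fU1; rewrite inE in rU.
    apply: cvg_near_cst; apply: nearW => m; apply: fU0.
    by move=> rU'; rewrite mem_set in rU.
  apply: (@cvg_monotone_convergence _ _ R (p s) setT measurableT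
    (fun m r => (f m r)%:E)).
  + by move=> m; apply/measurable_EFinP; exact: borel_continuous_measurable.
  + by move=> m x _; rewrite lee_fin; case/andP: (f01 m x).
  + by move=> x _ m n mn; rewrite lee_fin; exact: f_homo.
- move=> U mU pU.
  rewrite (_ : (fun s => _) = (fun s => 1 - p s U)%E); last first.
    by apply/funext => s; rewrite probability_setC.
  by apply: emeasurable_funB => //; exact: measurable_cst.
- move=> F mF tF pF.
  rewrite (_ : (fun s => _) = (fun s => \sum_(k <oo) p s (F k))%E); last first.
    by apply/funext => s; rewrite measure_bigcup//; apply: eq_eseriesl => k; rewrite in_setT.
  by apply: ge0_emeasurable_sum => // k s _ _.
Qed.

End measurable_kernels.

(** * Almost everywhere convergence from the parallelogram law *)

Section almost_everywhere_convergence.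
Context d {X : measurableType d} {R : realType}.
Variable Q : probability X R.
Implicit Types u v : nat -> X -> R.

Lemma cvgn_geometric_increments (u : nat -> R) (C : R) :
  (forall j, `|u j.+1 - u j| <= C / 2 ^+ j) -> cvgn u.
Proof.
move=> uC; rewrite (_ : u = fun n => series (telescope u) n + u 0%N); last first.
  by apply/funext => n; rewrite telescopeK subrK.
apply: is_cvgD; last exact: is_cvg_cst.
apply: normed_cvg; apply: (@series_le_cvg _ _ (geometric C 2^-1)).
- by move=> n /=.
- by move=> n; rewrite /geometric/= exprVn; exact: le_trans (normr_ge0 _) (uC n).
- by move=> n; rewrite /geometric/= exprVn; exact: uC.
- by apply: is_cvg_geometric_series; rewrite ger0_norm ?invr_ge0// invf_lt1// ltr1n.
Qed.

(** Weights with sum [1], in the form handled by [epsilon_trick0]. *)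
Let w (m : nat) : R := 1 / (2 ^ m.+1)%:R.

Let w_gt0 m : 0 < w m. Proof. by rewrite divr_gt0// ltr0n expn_gt0. Qed.

Let w_sqr_ge0 m (x : R) : 0 <= w m * x ^+ 2.
Proof. by rewrite mulr_ge0 ?sqr_ge0// ltW. Qed.

Definition weighted_sqr u (s : X) : \bar R :=
  (\sum_(m <oo) (w m * (u m s) ^+ 2)%:E)%E.

Let weighted_sqr_ge0 u s : (0 <= weighted_sqr u s)%E.
Proof. by apply: nneseries_ge0 => m _ _; rewrite lee_fin w_sqr_ge0. Qed.

Let measurable_weighted_sqr u : (forall m, measurable_fun setT (u m)) ->
  measurable_fun setT (weighted_sqr u).
Proof.
move=> mu; apply: ge0_emeasurable_sum => [k x _ _|k _].
  by rewrite lee_fin w_sqr_ge0.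
by apply/measurable_EFinP; apply: measurable_funM => //; exact: measurable_funX.
Qed.

(** The squared norm, possibly infinite, of [L^2(Q)] with values in a weighted space of
    square-summable sequences. *)
Definition sqnorm u : \bar R := (\int[Q]_s weighted_sqr u s)%E.

Let sqnorm_ge0 u : (0 <= sqnorm u)%E.
Proof. exact: integral_ge0. Qed.

Lemma sqnorm_le1 u : (forall m, measurable_fun setT (u m)) ->
  (forall m s, `|u m s| <= 1) -> (sqnorm u <= 1)%E.
Proof.
move=> mu u1; apply: (@le_trans _ _ (\int[Q]_s 1)%E); last first.
  by rewrite integral_cst// [X in (_ * X)%E](probability_setT Q) mule1.
apply: ge0_le_integral => //; first exact: measurable_weighted_sqr.
move=> s _; apply: le_trans (epsilon_trick0 xpredT ler01).
apply: lee_nneseries => [m _ _|m _]; rewrite lee_fin.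
  by rewrite mulr_ge0 ?sqr_ge0// ltW.
by rewrite ger_pMr// -real_normK ?num_real// expr_le1.
Qed.

Lemma sqnorm_parallelogram u v :
  (forall m, measurable_fun setT (u m)) -> (forall m, measurable_fun setT (v m)) ->
  (4%:E * sqnorm (fun m s => (u m s + v m s) / 2)%R +
   sqnorm (fun m s => u m s - v m s)%R = 2%:E * sqnorm u + 2%:E * sqnorm v)%E.
Proof.
move=> mu mv.
have muv m : measurable_fun setT (fun s => (u m s + v m s) / 2).
  by apply: measurable_funM => //; exact: measurable_funD.
have mumv m : measurable_fun setT (fun s => u m s - v m s) by exact: measurable_funB.
have Z (a : R) z : 0 <= a -> (forall m, measurable_fun setT (z m)) ->
    (a%:E * sqnorm z = \int[Q]_s (a%:E * weighted_sqr z s))%E.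
  by move=> a0 mz; rewrite ge0_integralZl//; exact: measurable_weighted_sqr.
have Z0 (a : R) z s : 0 <= a -> (0 <= a%:E * weighted_sqr z s)%E.
  by move=> a0; rewrite mule_ge0// lee_fin.
have mZ (a : R) z : (forall m, measurable_fun setT (z m)) ->
    measurable_fun setT (fun s => a%:E * weighted_sqr z s)%E.
  by move=> mz; apply: emeasurable_funM => //; exact: measurable_weighted_sqr.
rewrite !Z// /sqnorm -!ge0_integralD//.
all: try by [exact: mZ|exact: measurable_weighted_sqr|move=> s _; exact: Z0].
apply: eq_integral => s _; rewrite /weighted_sqr -!nneseriesZl.
all: try by move=> i _; rewrite lee_fin w_sqr_ge0.
rewrite -!nneseriesD.
all: try by move=> i _ _; rewrite -?EFinM lee_fin ?w_sqr_ge0// mulr_ge0// w_sqr_ge0.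
apply: eq_eseriesr => m _; rewrite -!EFinM -!EFinD; congr EFin.
by field.
Qed.

(** The series [G] of the squared increments weighted by [4^j] has integral at most [1], the sum of
    [1/2^(j+1)], so it is finite almost everywhere. Where it is, the increments of each coordinate
    [m] are at most [sqrt (G / w m) / 2^j]. *)
Lemma sqnorm_cvg_ae (u : nat -> nat -> X -> R) :
  (forall j m, measurable_fun setT (u j m)) ->
  (forall j, (sqnorm (fun m s => u j m s - u j.+1 m s)%R <=
     (1 / (2 ^ j.+1)%:R / 4 ^+ j)%:E)%E) ->
  \forall s \ae Q, forall m, cvgn (fun j => u j m s).
Proof.
move=> mu hu.
pose z j m s : R := u j m s - u j.+1 m s.
have mz j m : measurable_fun setT (z j m) by exact: measurable_funB.
pose G s : \bar R := (\sum_(j <oo) (4 ^+ j)%:E * weighted_sqr (z j) s)%E.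
have mGj j : measurable_fun setT (fun s => (4 ^+ j)%:E * weighted_sqr (z j) s)%E.
  by apply: emeasurable_funM => //; exact: measurable_weighted_sqr.
have Gj0 j s : (0 <= (4 ^+ j)%:E * weighted_sqr (z j) s)%E.
  by rewrite mule_ge0// lee_fin exprn_ge0.
have mG : measurable_fun setT G.
  by apply: ge0_emeasurable_sum.
have intG : (\int[Q]_s G s <= 1)%E.
  rewrite /G integral_nneseries//.
  apply: le_trans (epsilon_trick0 xpredT ler01).
  apply: lee_nneseries => [j _ _|j _]; first exact: integral_ge0.
  rewrite ge0_integralZl//; last exact: measurable_weighted_sqr.
  apply: (le_trans (lee_wpmul2l _ (hu j))); first by rewrite lee_fin exprn_ge0.
  by rewrite -EFinM lee_fin mulrC divfK// expf_neq0.
have : Q.-integrable setT G.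
  apply/integrableP; split => //.
  under eq_integral do rewrite gee0_abs ?nneseries_ge0//.
  by rewrite (le_lt_trans intG)// ltry.
move=> /(integrable_ae measurableT); apply: filterS => s /(_ I) Gfin m.
pose C := Num.sqrt (fine (G s) / w m).
apply: (@cvgn_geometric_increments _ C) => j.
have w0 := w_gt0 m.
have G0 : 0 <= fine (G s) by apply: fine_ge0; exact: nneseries_ge0.
have H : 4 ^+ j * (w m * (z j m s) ^+ 2) <= fine (G s).
  rewrite -lee_fin fineK// EFinM.
  apply: (@le_trans _ _ ((4 ^+ j)%:E * weighted_sqr (z j) s)%E).
    apply: lee_wpmul2l; first by rewrite lee_fin exprn_ge0.
    apply: le_trans (nneseries_lim_ge m.+1 _) => //=; last first.
      by move=> i _ _; rewrite lee_fin w_sqr_ge0.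
    rewrite big_nat_recr//= leeDr// sume_ge0// => i _.
    by rewrite lee_fin w_sqr_ge0.
  apply: le_trans (nneseries_lim_ge j.+1 _) => //=.
  by rewrite big_nat_recr//= leeDr// sume_ge0.
rewrite -ler_sqr ?nnegrE ?divr_ge0 ?sqrtr_ge0 ?exprn_ge0//.
rewrite real_normK ?num_real// -sqrrN opprB -/(z j m s) expr_div_n.
rewrite sqr_sqrtr ?divr_ge0 ?(ltW w0)//.
rewrite -exprM mulnC exprM (_ : 2 ^+ 2 = 4 :> R); last by rewrite -natrX.
rewrite ler_pdivlMr ?exprn_gt0// ler_pdivlMr//.
by apply: le_trans H; rewrite le_eqVlt; apply/orP; left; apply/eqP; ring.
Qed.

(* Among the [p] in [D j] choose one whose norm is almost minimal; by the
   parallelogram law and midpoint convexity two such choices are close. *)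
Lemma midconvex_cvg_ae (T : Type) (D : nat -> set T) (a : T -> nat -> X -> R) :
  (forall p m, measurable_fun setT (a p m)) ->
  (forall p m s, `|a p m s| <= 1) ->
  (forall n, D n !=set0) -> (forall m n, (m <= n)%N -> D n `<=` D m) ->
  (forall n p q, D n p -> D n q ->
    exists2 r, D n r & forall m s, a r m s = (a p m s + a q m s) / 2) ->
  exists p : nat -> T, (forall j, D j (p j)) /\
    \forall s \ae Q, forall m, cvgn (fun j => a (p j) m s).
Proof.
move=> ma a1 D0 Dhomo Dmid.
pose J p := fine (sqnorm (a p)).
have sqnorm_fin u : (sqnorm u <= 1)%E -> sqnorm u \is a fin_num.
  by move=> u1; rewrite ge0_fin_numE// (le_lt_trans u1)// ltry.
have sa p : sqnorm (a p) \is a fin_num by apply: sqnorm_fin; exact: sqnorm_le1.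
have J0 p : 0 <= J p by exact: fine_ge0.
have J1 p : J p <= 1 by rewrite -lee_fin fineK//; exact: sqnorm_le1.
(* The infima over the decreasing sets [D n] increase with [n] and are at most [1]; their supremum
   [dd] is thus also their limit. *)
pose dn n := inf [set J p | p in D n].
have hasinf n : has_inf [set J p | p in D n].
  split; first by have [p Dp] := D0 n; exists (J p), p.
  by exists 0 => _ [p _ <-].
have dn_le n p : D n p -> dn n <= J p.
  by move=> Dp; apply: ge_inf; [case: (hasinf n)|exists p].
have dn_homo m n : (m <= n)%N -> dn m <= dn n.
  move=> mn; apply: lb_le_inf; first by case: (hasinf n).
  by move=> _ [p Dp <-]; apply: dn_le; exact: Dhomo Dp.
have dn1 n : dn n <= 1.
  by have [p Dp] := D0 n; rewrite (le_trans (dn_le _ _ Dp)).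
pose dd := sup (range dn).
have hassup : has_sup (range dn).
  by split; [exists (dn 0%N), 0%N|exists 1 => _ [n _ <-]].
have dn_dd n : dn n <= dd by apply: ub_le_sup; [case: hassup|exists n].
(* Chosen so that [8 * e j] is the bound required by [sqnorm_cvg_ae]. The parallelogram law will
   give [2 (dd + e j) + 2 (dd + e j.+1) - 4 (dd - e j)], which is at most [8 * e j]. *)
pose e j : R := 1 / (2 ^ j.+1)%:R / 4 ^+ j / 8.
have e0 j : 0 < e j by rewrite !divr_gt0// ?ltr0n ?expn_gt0// exprn_gt0.
have e_dec j : e j.+1 <= e j.
  rewrite /e ler_pM2r ?invr_gt0// ler_pM ?invr_ge0 ?divr_ge0 ?exprn_ge0//.
    by rewrite ler_pM2l// lef_pV2 ?posrE ?ltr0n ?expn_gt0// ler_nat leq_exp2l.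
  by rewrite lef_pV2 ?posrE ?exprn_gt0// ler_eXn2l// ltr1n.
have /choice[N NP] : forall j, exists N, (j <= N)%N /\ dd - e j < dn N.
  move=> j; have [_ [N _ <-] NP] := sup_adherent (e0 j) hassup.
  exists (maxn j N); rewrite leq_maxl; split => //.
  by rewrite (lt_le_trans NP)// dn_homo// leq_maxr.
have /choice[p pP] : forall j, exists p, D (N j) p /\ J p < dd + e j.
  move=> j; have [_ [p Dp <-] Jp] := inf_adherent (e0 j) (hasinf (N j)).
  by exists p; split => //; rewrite (lt_le_trans Jp)// lerD2r; exact: dn_dd.
exists p; split; first by move=> j; apply: Dhomo (pP j).1; exact: (NP j).1.
apply: (sqnorm_cvg_ae (u := fun j => a (p j))) => // j.
(* At this index [D n] contains [p j] and [p j.+1], hence a midpoint [r] of the two, and [dn n] is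
   still at least [dd - e j]. *)
pose n := minn (N j) (N j.+1).
have dn_n : dd - e j <= dn n.
  rewrite /n; have [_|_] := leqP (N j) (N j.+1); first exact: ltW (NP j).2.
  by apply: le_trans (ltW (NP j.+1).2); rewrite lerD2l lerN2.
have [r Dr rE] := Dmid n (p j) (p j.+1) (Dhomo _ _ (geq_minl _ _) _ (pP j).1)
  (Dhomo _ _ (geq_minr _ _) _ (pP j.+1).1).
have := sqnorm_parallelogram (ma (p j)) (ma (p j.+1)).
rewrite (_ : (fun m s => (_ + _) / 2) = a r); last first.
  by apply/funext => m; apply/funext => s; rewrite rE.
rewrite -[sqnorm (a r)]fineK// -[sqnorm (a (p j))]fineK// -[sqnorm (a (p j.+1))]fineK//.
rewrite -/(J _) -/(J _) -/(J _) -!EFinM -EFinD => E.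
have le1 := le_trans dn_n (dn_le _ _ Dr).
have le2 := (pP j).2; have le3 := (pP j.+1).2; have le4 := e_dec j.
have fin_diff : sqnorm (fun m s => a (p j) m s - a (p j.+1) m s) \is a fin_num.
  rewrite ge0_fin_numE// ltey; apply/eqP => Eoo.
  by move: E; rewrite Eoo addey.
move: E; rewrite -(fineK fin_diff) -EFinD => -[E].
rewrite lee_fin (_ : 1 / _ / _ = 8 * e j); last by rewrite /e [RHS]mulrC divfK.
lra.
Qed.

End almost_everywhere_convergence.

(** * Limits of probabilities and of real sequences *)

(** Convergence of the integrals of all continuous functions is pointwise convergence of
    [weak_star_eval], hence convergence in the initial topology. *)
Lemma weak_star_closed_lim {R : realType} {S : ptopologicalType}
    (K : set (probability (borel S) R)) (P : nat -> probability (borel S) R)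
    (Q : probability (borel S) R) :
  weak_star_closed K -> (forall j, K (P j)) ->
  (forall f : S -> R, continuous f ->
     (fun j => \int[P j]_r f r) @ \oo --> \int[Q]_r f r) ->
  K Q.
Proof.
move=> cK KP PQ; pose W := initial_topology (@weak_star_eval R S).
have PQW : (P : nat -> W) @ \oo --> (Q : W).
  move=> A /= [_ [[B oB <-] BQ] BA].
  have evP : {ptws, (fun j => weak_star_eval (P j)) @ \oo --> weak_star_eval Q}.
    apply/cvg_sup => f A' [_ [[V oV <-] VQ] VA].
    have /(PQ _ (@cts_fun _ _ f)) : nbhs (\int[Q]_r f r) V by exact: open_nbhs_nbhs.
    by rewrite !nbhs_filterE /=; apply: filterS => j Vj; exact: VA.
  have /evP : nbhs (weak_star_eval Q) B by apply: open_nbhs_nbhs.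
  by rewrite !nbhs_filterE /=; apply: filterS => j Bj; exact: BA.
have KPn : \forall j \near \oo, K (P j) by exact: nearW.
exact: (@closed_cvg _ W _ _ (P : nat -> W) K cK KPn Q PQW).
Qed.

Lemma cvgn_unif_approx {R : realType} (u : nat -> R) :
  (forall e : R, 0 < e -> exists2 v : nat -> R, cvgn v & forall j, `|u j - v j| <= e) ->
  cvgn u.
Proof.
move=> H; apply: cauchy_cvg; apply: cauchy_exP => e e0.
have e4 : 0 < e / 4 by rewrite divr_gt0.
have [v /cvg_ex[l vl] uv] := H _ e4.
exists l; rewrite nbhs_filterE /fmap /=.
have /cvgrPdist_lt/(_ _ e4) := vl; apply: filterS => j lj.
rewrite /= -ball_normE /=.
rewrite -(subrK (v j) l) -addrA (le_lt_trans (ler_normD _ _))//.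
have := uv j; rewrite distrC => uvj.
by rewrite (le_lt_trans (lerD (ltW lj) uvj))// -mulrDr; lra.
Qed.

Lemma is_cvgn_sum {R : realType} (I : Type) (s : seq I) (u : I -> nat -> R) :
  (forall i, cvgn (u i)) -> cvgn (fun j => \sum_(i <- s) u i j).
Proof.
move=> cu; elim: s => [|i s IH].
  by under eq_fun do rewrite big_nil; exact: is_cvg_cst.
by under eq_fun do rewrite big_cons; apply: is_cvgD.
Qed.

Lemma continuous_pairl {R : realType} {S : topologicalType} (h : S * S -> R) r :
  continuous h -> continuous (fun s => h (s, r)).
Proof.
move=> ch s; apply: (@continuous_comp _ _ _ (fun s => (s, r)) h); last exact: ch.
by apply: cvg_pair; [exact: cvg_id|exact: cvg_cst].
Qed.

Lemma continuous_pairr {R : realType} {S : topologicalType} (h : S * S -> R) s :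
  continuous h -> continuous (fun r => h (s, r)).
Proof.
move=> ch r; apply: (@continuous_comp _ _ _ (fun r => (s, r)) h); last exact: ch.
by apply: cvg_pair; [exact: cvg_cst|exact: cvg_id].
Qed.

(** * Integrals against kernels and limits of kernels *)

Section limit_kernels.
Context {R : realType} {S : ptopologicalType}.
Hypothesis S_compact : compact [set: S].
Hypothesis open_approx : open_indic_approximable R S.
Variables (n : nat -> nat) (x : nat -> nat -> S) (psi : nat -> nat -> S -> R).
Hypothesis psi_continuous : forall k i, continuous (psi k i).
Hypothesis psi01 : forall k i r, 0 <= psi k i r <= 1.
Hypothesis psi_approx : forall (h : S * S -> R) (e : R), continuous h -> 0 < e ->
  exists k, forall s r,
    `|h (s, r) - \sum_(i < n k) h (s, x k i) * psi k i r| <= e.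

Let cbm (f : S -> R) : continuous f -> bounded_measurable (f : borel S -> R).
Proof. exact: continuous_bounded_measurable. Qed.

Let approx_bm (g : nat -> R) k :
  bounded_measurable (fun r : borel S => \sum_(i < n k) g i * psi k i r).
Proof.
apply: bounded_measurable_sum => i; apply: bounded_measurableM.
  exact: bounded_measurable_cst.
exact: cbm.
Qed.

Let Rintegral_approx (P : probability (borel S) R) (g : nat -> R) k :
  \int[P]_r (\sum_(i < n k) g i * psi k i r) =
  \sum_(i < n k) g i * \int[P]_r psi k i r.
Proof.
rewrite Rintegral_prob_sum; last first.
  by move=> i; apply: bounded_measurableM; [exact: bounded_measurable_cst|exact: cbm].
by apply: eq_bigr => i _; rewrite Rintegral_probZ//; exact: cbm.
Qed.

(** Convergence passes from the [psi k i] to their combinations and, by uniform approximation, to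
    every continuous function. The limit is a positive normalised functional, so the Riesz theorem
    represents it. *)
Lemma limit_probability (P : nat -> probability (borel S) R) :
  (forall k i, cvgn (fun j => \int[P j]_r psi k i r)) ->
  exists Q : probability (borel S) R, forall f : S -> R, continuous f ->
    (fun j => \int[P j]_r f r) @ \oo --> \int[Q]_r f r.
Proof.
move=> cvg_psi.
have cvgf (f : S -> R) : continuous f -> cvgn (fun j => \int[P j]_r f r).
  move=> cf; apply: cvgn_unif_approx => e e0.
  (* [f] is viewed as a function of the pair that is constant in its first argument, the form that
     [psi_approx] takes. *)
  have ch : continuous (fun sr : S * S => f sr.2).
    by move=> sr; apply: (@continuous_comp _ _ _ snd f); [exact: cvg_snd|exact: cf].
  have [k fk] := psi_approx ch e0.
  exists (fun j => \int[P j]_r \sum_(i < n k) f (x k i) * psi k i r).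
    under eq_fun do rewrite (Rintegral_approx _ (fun i => f (x k i))).
    apply: (is_cvgn_sum (u := fun (i : 'I_(n k)) j => f (x k i) * \int[P j]_r psi k i r)) => i.
    by apply: is_cvgM; [exact: is_cvg_cst|exact: cvg_psi].
  move=> j; apply: Rintegral_prob_dist; [exact: cbm|exact: (approx_bm (fun i => f (x k i)))|].
  by move=> r; exact: (fk r r).
pose L (f : S -> R) := limn (fun j => \int[P j]_r f r).
have [||||Q QL] := @riesz_representation R S S_compact open_approx L.
- move=> f g cf cg; rewrite /L.
  under eq_fun => j do (rewrite Rintegral_probD; [|exact: cbm|exact: cbm]).
  by rewrite limD//; exact: cvgf.
- move=> a f cf; rewrite /L.
  under eq_fun => j do (rewrite Rintegral_probZ; [|exact: cbm]).
  by apply/cvg_lim => //; apply: cvgM; [exact: cvg_cst|exact: cvgf].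
- move=> f cf f0; apply: limr_ge; first exact: cvgf.
  by apply: nearW => j; apply: Rintegral_ge0 => r _; exact: f0.
- by rewrite /L; under eq_fun do rewrite Rintegral_prob_cst; exact: lim_cst.
by exists Q => f cf; rewrite QL//; exact: cvgf.
Qed.

Variable mu : probability (borel S) R.
Local Notation X := (caratheodory_type (mu^*)%mu).
Implicit Type p : S -> probability (borel S) R.

Definition measurable_kernel_fun p :=
  measurable_fun [set: X] (p : X -> pprobability (borel S) R).

(** The variable [s] enters through both [h] and [p s]. The approximation by the [psi k i] separates
    the two: the integral is a limit of finite sums of products of a continuous function of [s] and
    an integral against [p s]. *)
Lemma section_integral_bounded_measurable p (h : S * S -> R) :
  measurable_kernel_fun p -> continuous h ->
  bounded_measurable (fun s : X => \int[p s]_r h (s, r)).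
Proof.
move=> mp ch.
have cptSS : compact [set: S * S] by rewrite -setXTT; exact: compact_setX.
split; last first.
  have [M _ hM] := compact_bounded cptSS ch; exists M => s.
  rewrite -[X in `|X|]subr0 -(Rintegral_prob_cst (p s) 0).
  apply: Rintegral_prob_dist; first exact/cbm/continuous_pairr.
    exact: bounded_measurable_cst.
  by move=> r; rewrite subr0.
have /choice[k kP] : forall m : nat, exists k, forall s r,
    `|h (s, r) - \sum_(i < n k) h (s, x k i) * psi k i r| <= m.+1%:R^-1.
  by move=> m; apply: psi_approx.
apply: (@measurable_fun_cvg _ _ _ _
  (fun m (s : X) => \sum_(i < n (k m)) h (s, x (k m) i) * \int[p s]_r psi (k m) i r)).
  move=> m; apply: measurable_sum => i; apply: measurable_funM.
    apply: borel_measurable_fun_completion; apply: borel_continuous_measurable.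
    exact: continuous_pairl.
  by have [] := measurable_kernel_integral S_compact mp (@psi_continuous (k m) i).
move=> s _; apply/cvgrPdist_le => e e0.
near=> m; rewrite -(Rintegral_approx _ (fun i => h (s, x (k m) i))).
apply: (@le_trans _ _ m.+1%:R^-1).
  apply: Rintegral_prob_dist; [exact/cbm/continuous_pairr|exact: (approx_bm (fun i => h (s, x (k m) i)))|].
  by move=> r; exact: kP.
by apply: ltW; near: m; exact: near_infty_natSinv_lt (PosNum e0).
Unshelve. all: by end_near. Qed.

(** Real-valued form of [kernel_integral], for calculations in [R]. *)
Definition kint p (h : S * S -> R) : R :=
  \int[completion mu]_s \int[p s]_r h (s, r).

Lemma kernel_integralE p (h : S * S -> R) : measurable_kernel_fun p ->
  continuous h -> kernel_integral mu p h = (kint p h)%:E.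
Proof.
move=> mp ch; rewrite /kint EFin_Rintegral; last exact: section_integral_bounded_measurable.
apply: eq_integral => s _; rewrite EFin_Rintegral//.
exact/cbm/continuous_pairr.
Qed.

Lemma kintB p (f g : S * S -> R) (a : R) : measurable_kernel_fun p ->
  continuous f -> continuous g ->
  kint p (fun sr => f sr - a * g sr) = kint p f - a * kint p g.
Proof.
move=> mp cf cg; rewrite /kint.
have bf := section_integral_bounded_measurable mp cf.
have bg := section_integral_bounded_measurable mp cg.
have bag := bounded_measurableM (bounded_measurable_cst a) bg.
rewrite -(Rintegral_probZ (completion mu) a bg).
rewrite -(Rintegral_probB (completion mu) bf bag).
apply: eq_Rintegral => s _.
have bfs := cbm (@continuous_pairr _ _ f s cf).
have bgs := cbm (@continuous_pairr _ _ g s cg).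
have bags := bounded_measurableM (bounded_measurable_cst a) bgs.
by rewrite (Rintegral_probB (p s) bfs bags) (Rintegral_probZ (p s) a bgs).
Qed.

Lemma kint_bound p (h : S * S -> R) (M : R) : measurable_kernel_fun p ->
  continuous h -> (forall sr, `|h sr| <= M) -> `|kint p h| <= M.
Proof.
move=> mp ch hM; rewrite -[kint p h]subr0 -(Rintegral_prob_cst (completion mu) 0).
apply: Rintegral_prob_dist; first exact: section_integral_bounded_measurable.
  exact: bounded_measurable_cst.
move=> s; rewrite -(Rintegral_prob_cst (p s) 0).
apply: Rintegral_prob_dist; first exact/cbm/continuous_pairr.
  exact: bounded_measurable_cst.
by move=> r; rewrite subr0.
Qed.

Definition mixture_kernel p q (t : R) (t01 : 0 <= t <= 1) :
  S -> probability (borel S) R := fun s => mixture (p s) (q s) t01.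

Lemma measurable_mixture_kernel p q (t : R) (t01 : 0 <= t <= 1) :
  measurable_kernel_fun p -> measurable_kernel_fun q ->
  measurable_kernel_fun (mixture_kernel p q t01).
Proof.
move=> mp mq; apply: (kernel_integral_measurable S_compact open_approx) => f cf.
rewrite (_ : (fun s => _) =
    fun s => t * \int[p s]_r f r + (1 - t) * \int[q s]_r f r); last first.
  by apply/funext => s; rewrite Rintegral_mixture//; exact: cbm.
have [mpf _] := measurable_kernel_integral S_compact mp cf.
have [mqf _] := measurable_kernel_integral S_compact mq cf.
by apply: measurable_funD; apply: measurable_funM.
Qed.

Lemma kint_mixture p q (t : R) (t01 : 0 <= t <= 1) (h : S * S -> R) :
  measurable_kernel_fun p -> measurable_kernel_fun q -> continuous h ->
  kint (mixture_kernel p q t01) h = t * kint p h + (1 - t) * kint q h.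
Proof.
move=> mp mq ch; rewrite /kint.
have bp := section_integral_bounded_measurable mp ch.
have bq := section_integral_bounded_measurable mq ch.
have btp := bounded_measurableM (bounded_measurable_cst t) bp.
have btq := bounded_measurableM (bounded_measurable_cst (1 - t)) bq.
rewrite -(Rintegral_probZ (completion mu) t bp) -(Rintegral_probZ (completion mu) (1 - t) bq).
rewrite -(Rintegral_probD (completion mu) btp btq).
apply: eq_Rintegral => s _; rewrite Rintegral_mixture//.
exact/cbm/continuous_pairr.
Qed.

Variable K : S -> set (probability (borel S) R).
Hypothesis K_ae : \forall s \ae mu,
  [/\ K s !=set0, weak_star_closed (K s) & convex_probabilities (K s)].

Lemma kernel_in_mixture p q (t : R) (t01 : 0 <= t <= 1) :
  kernel_in mu K p -> kernel_in mu K q ->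
  kernel_in mu K (mixture_kernel p q t01).
Proof.
move=> [mp Kp] [mq Kq]; split; first exact: measurable_mixture_kernel.
have aeF := ae_filter_ringOfSetsType mu.
apply: (@filterS3 _ _ aeF _ _ _ _ _ Kp Kq K_ae) => s Kps Kqs [_ _ cK].
by apply: (cK (p s) (q s) (mixture (p s) (q s) t01) t Kps Kqs t01) => A _; exact: mixtureE.
Qed.

(** Replaces compactness of the set of kernels. The almost-minimal choice in the convex sets [D j]
    makes the integrals of all [psi k i] converge for almost every [s], and the limit kernel is
    formed pointwise. *)
Lemma kernel_in_limit (D : nat -> set (S -> probability (borel S) R)) :
  (forall n, D n !=set0) -> (forall m n, (m <= n)%N -> D n `<=` D m) ->
  (forall n, D n `<=` kernel_in mu K) ->
  (forall n p q (t : R) (t01 : 0 <= t <= 1),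
     D n p -> D n q -> D n (mixture_kernel p q t01)) ->
  exists (p : nat -> S -> probability (borel S) R) (q : S -> probability (borel S) R),
    [/\ forall j, D j (p j), kernel_in mu K q &
      forall h, continuous h -> (fun j => kint (p j) h) @ \oo --> kint q h].
Proof.
move=> D0 Dhomo DK Dmid.
have half01 : 0 <= (2^-1 : R) <= 1.
  by rewrite invr_ge0 ler0n/= invf_le1// ler1n.
(* Enumerates the pairs [(k, i)] by one index; a number that codes no pair repeats [(0, 0)]. *)
pose dec m : nat * nat := odflt (0%N, 0%N) (unpickle m).
pose Psi m := psi (dec m).1 (dec m).2.
have cPsi m : continuous (Psi m) by exact: psi_continuous.
(* Membership is bundled because [midconvex_cvg_ae] asks for measurability at every element of its
   index type. *)
pose T := {p | kernel_in mu K p}.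
pose a (p : T) m (s : X) := \int[sval p s]_r Psi m r.
have ma (p : T) m : bounded_measurable (a p m).
  exact: (measurable_kernel_integral S_compact (svalP p).1 (@cPsi m)).
have [||||p' [Dp' good]] :=
  @midconvex_cvg_ae _ X R (completion mu) T
    (fun m => [set t : T | D m (sval t)]) a (fun t m => (ma t m).1).
- move=> p m s; rewrite -[a _ _ _]subr0 -(Rintegral_prob_cst (sval p s) 0).
  apply: Rintegral_prob_dist; [exact: cbm|exact: bounded_measurable_cst|].
  move=> r; rewrite subr0 ger0_norm; by have /andP[] := psi01 (dec m).1 (dec m).2 r.
- by move=> m; have [p Dp] := D0 m; exists (exist _ p (DK m p Dp)).
- by move=> m m' mm' t; exact: Dhomo.
- move=> m p q Dp Dq; have Kpq := kernel_in_mixture half01 (svalP p) (svalP q).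
  exists (exist _ _ Kpq); first exact: Dmid.
  move=> m' s; rewrite /a /= Rintegral_mixture; last exact: cbm.
  by rewrite (_ : 1 - 2^-1 = 2^-1 :> R); [rewrite -mulrDr mulrC|lra].
pose p j := sval (p' j); have mp j : measurable_kernel_fun (p j) := (svalP (p' j)).1.
pose good_set := [set s : X | forall m, cvgn (fun j => a (p' j) m s)].
(* The complement is null, hence measurable by completeness. *)
have mgood : measurable good_set.
  rewrite -[good_set]setCK; apply: measurableC.
  exact: (completion_complete (A := ~` good_set) good).
(* Off [good_set] the sequence is frozen at [p 0], so that it converges at every [s] and the limit
   [q] is measurable on the whole space. *)
pose p2 j s := if s \in good_set then p j s else p 0%N s.
have /choice[q qP] : forall s, exists Q : probability (borel S) R,
    forall f : S -> R, continuous f ->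
    (fun j => \int[p2 j s]_r f r) @ \oo --> \int[Q]_r f r.
  move=> s; apply: limit_probability => k i; rewrite /p2.
  have [sg|sg] := boolP (s \in good_set); last exact: is_cvg_cst.
  rewrite inE in sg; have := sg (pickle (k, i)).
  by rewrite /a /Psi /dec pickleK.
have mq : measurable_kernel_fun q.
  apply: (kernel_integral_measurable S_compact open_approx) => f cf.
  apply: (@measurable_fun_cvg _ _ _ _ (fun j (s : X) => \int[p2 j s]_r f r)).
    move=> j; rewrite (_ : (fun s => _) = fun s : X =>
        if s \in good_set then \int[p j s]_r f r else \int[p 0%N s]_r f r); last first.
      by apply/funext => s; rewrite /p2; case: ifP.
    apply: measurable_fun_ifT.
      by apply: (measurable_fun_bool true); rewrite setTI preimage_mem_true.
      by have [] := measurable_kernel_integral S_compact (mp j) cf.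
    by have [] := measurable_kernel_integral S_compact (mp 0%N) cf.
  by move=> s _; exact: qP.
have q_lim s : good_set s -> forall f : S -> R, continuous f ->
    (fun j => \int[p j s]_r f r) @ \oo --> \int[q s]_r f r.
  by move=> sg f cf; have := qP s f cf; rewrite /p2 (mem_set sg).
exists p, q; split => //.
  split => //.
  have Kp : \forall s \ae mu, forall j, K s (p j s).
    by apply: ae_foralln => j; exact: (svalP (p' j)).2.
  have good_mu : \forall s \ae mu, good_set s by apply/ae_completion.
  have aeF := ae_filter_ringOfSetsType mu.
  apply: (@filterS3 _ _ aeF _ _ _ _ _ Kp good_mu K_ae) => s Kps sg [_ clK _].
  exact: (weak_star_closed_lim clK Kps (q_lim s sg)).
move=> h ch.
have cptSS : compact [set: S * S] by rewrite -setXTT; exact: compact_setX.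
have [M M0 hM] := compact_bounded cptSS ch.
have hb (P : probability (borel S) R) s : `|\int[P]_r h (s, r)| <= M.
  rewrite -[X in `|X|]subr0 -(Rintegral_prob_cst P 0).
  apply: Rintegral_prob_dist; first exact/cbm/continuous_pairr.
    exact: bounded_measurable_cst.
  by move=> r; rewrite subr0.
have bmp j := section_integral_bounded_measurable (mp j) ch.
have bmq := section_integral_bounded_measurable mq ch.
have [|||||_ _ cvg_int] := @dominated_convergence _ X R (completion mu) setT measurableT
  (fun j s => (\int[p j s]_r h (s, r))%:E) (fun s => (\int[q s]_r h (s, r))%:E)
  (fun=> M%:E).
- by move=> j; apply/measurable_EFinP; exact: (bmp j).1.
- by apply/measurable_EFinP; exact: bmq.1.
- apply: filterS good => s sg _; apply/cvg_EFin; first exact: nearW.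
  by apply: q_lim => //; exact: continuous_pairr.
- exact: (bounded_measurable_integrable (completion mu) (bounded_measurable_cst M)).
- by apply: aeW => s j _; rewrite lee_fin.
by apply: fine_cvg; rewrite EFin_Rintegral.
Qed.

End limit_kernels.

(* The value function [sup {L p | C p <= t}] is concave and at most [v] on
   [t < eps + eta]; [lam] is the slope of a line above it through [(eps, v)]. *)
Lemma lagrange_multiplier {R : realType} (T : Type) (A : set T) (C L : T -> R)
    (eps v eta M : R) :
  0 < eta ->
  (forall p, A p -> C p < eps + eta -> L p <= v) ->
  (forall p, A p -> L p <= M) ->
  (forall p q (t : R), 0 <= t <= 1 -> A p -> A q ->
    exists2 r, A r & C r = t * C p + (1 - t) * C q /\
                     L r = t * L p + (1 - t) * L q) ->
  exists2 lam : R, 0 <= lam & forall p, A p -> L p <= v + lam * (C p - eps).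
Proof.
move=> eta0 Lv LM Aconv.
(* Slopes of the lines from [(eps, v)] to the points [(C p, L p)] on its right. Adding [0] to them
   makes the supremum non-negative and the set non-empty. *)
pose slopes := [set s | exists2 p, A p & eps < C p /\ s = (L p - v) / (C p - eps)].
pose E := [set s : R | s = 0 \/ slopes s].
have supE : has_sup E.
  split; first by exists 0; left.
  (* For [C p < eps + eta] the slope is at most [0] since [L p <= v]; beyond, the denominator is at
     least [eta] and the numerator at most [M - v]. *)
  exists (Num.max 0 ((M - v) / eta)) => _ [->|[p Ap [Cp ->]]].
    by rewrite le_max lexx.
  have Cp0 : 0 < C p - eps by rewrite subr_gt0.
  rewrite le_max; have [Cpe|Cpe] := ltP (C p) (eps + eta).
    by rewrite ler_pdivrMr// mul0r subr_le0 Lv.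
  have [vM|Mv] := leP v (L p); last first.
    by rewrite ler_pdivrMr// mul0r subr_le0 ltW.
  apply/orP; right; apply: (@le_trans _ _ ((L p - v) / eta)).
    by rewrite ler_wpM2l ?subr_ge0// lef_pV2 ?posrE// lerBrDl.
  by rewrite ler_pM2r ?invr_gt0// lerD2r LM.
exists (sup E) => [|p Ap].
  by apply: ub_le_sup; [case: supE|left].
rewrite -lerBlDl; have [Cp|Cp|Cp] := ltgtP (C p) eps; last first.
- by rewrite Cp subrr mulr0 subr_le0 Lv// Cp ltrDl.
- rewrite -ler_pdivrMr ?subr_gt0//; apply: ub_le_sup; first by case: supE.
  by right; exists p.
have Cp0 : 0 < eps - C p by rewrite subr_gt0.
have Lpv : L p <= v by rewrite Lv// (lt_trans Cp)// ltrDl.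
rewrite -lerN2 -mulrN !opprB -ler_pdivlMr//.
apply: ge_sup => [|_ [->|[q Aq [Cq ->]]]]; first by case: supE.
  by rewrite divr_ge0 ?subr_ge0// ltW.
have Cq0 : 0 < C q - eps by rewrite subr_gt0.
have Cqp : 0 < C q - C p by rewrite subr_gt0 (lt_trans Cp).
(* With [C p < eps < C q], this weight gives the mixture [r] of [p] and [q] cost exactly [eps]; then
   [L r <= v] says that the slope to [q] is at most the slope of the line from [(C p, L p)] to
   [(eps, v)]. *)
pose t := (C q - eps) / (C q - C p).
have t1 : 1 - t = (eps - C p) / (C q - C p).
  by rewrite /t -[X in X - _](@divff _ (C q - C p)) ?gt_eqF// -mulrBl; congr (_ / _); ring.
have t01 : 0 <= t <= 1.
  apply/andP; split; first by rewrite /t divr_ge0// ltW.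
  by rewrite -subr_ge0 t1 divr_ge0// ltW.
have [r Ar [Cr Lr]] := Aconv p q t t01 Ap Aq.
have {}Cr : C r = eps.
  by rewrite Cr t1 /t; field; rewrite gt_eqF.
have := Lv r Ar; rewrite Cr ltrDl => /(_ eta0).
rewrite Lr t1 /t mulrAC [X in _ + X]mulrAC -mulrDl ler_pdivrMr// => H.
rewrite ler_pdivrMr// mulrAC ler_pdivlMr//; lra.
Qed.

(** * Duality for kernels with bounded expected cost *)

Theorem theorem3p1 (R : realType) (S : ptopologicalType)
    (S_compact : compact [set: S]) (S_polish : polish_space R S)
    (mu : probability (borel S) R) (eps : R) (eps_ge0 : 0 <= eps)
    (dG : measure_display) (Gam : measurableType dG)
    (ell : S -> Gam -> R) (ell_ge0 : forall s g, 0 <= ell s g)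
    (ell_measurable :
       measurable_fun [set: borel S * Gam]
         (fun sg : borel S * Gam => ell sg.1 sg.2))
    (G : Gam) (ell_continuous : continuous (fun s : S => ell s G))
    (K : S -> set (probability (borel S) R))
    (c : S * S -> R) (c_ge0 : forall sr, 0 <= c sr)
    (c_continuous : continuous c)
    (c_eq0 : forall s r, c (s, r) = 0 <-> s = r)
    (K_ae : \forall s \ae mu,
       [/\ K s !=set0, weak_star_closed (K s) & convex_probabilities (K s)])
    (Omega_neq0 : Omega mu K c eps !=set0) :
  I_Omega mu K c eps ell G =
  ereal_inf [set ((lh.1 * eps)%:E +
                  ereal_sup [set kernel_integral mu p lh.2
                            | p in kernel_in mu K])%E
            | lh in Delta mu K c ell G].
Proof.
have [n [x [psi [cpsi psi01 psi_sum psi_supp]]]] :=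
  countable_partition_of_unity S_compact c_continuous c_eq0.
have psi_app := @psi_approx R S c S_compact c_ge0 c_continuous c_eq0 n x psi
  psi01 psi_sum psi_supp.
have open_app := @open_indic_approx R S c S_compact c_ge0 c_continuous c_eq0
  n x psi cpsi psi01 psi_sum psi_supp.
pose l (sr : S * S) : R := ell sr.2 G.
have cl : continuous l.
  by move=> sr; apply: (@continuous_comp _ _ _ snd (fun s => ell s G)); [exact: cvg_snd|exact: ell_continuous].
have KE p h : kernel_in mu K p -> continuous h ->
    kernel_integral mu p h = (kint mu p h)%:E.
  by move=> [mp _] ch; exact: (kernel_integralE S_compact cpsi psi_app).
have kB p (lam : R) : kernel_in mu K p ->
    kint mu p (fun sr => l sr - lam * c sr) = kint mu p l - lam * kint mu p c.
  by move=> [mp _]; exact: (kintB S_compact cpsi psi_app).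
have clc (lam : R) : continuous (fun sr => l sr - lam * c sr).
  by apply: continuousfB => //; apply: continuousfM => //; exact: continuousf_cst.
apply/eqP; rewrite eq_le; apply/andP; split.
  (* Weak duality: the integral of [l] is that of [l - lam c] plus [lam] times the cost, which is at
     most the integral of [h] plus [lam * eps]. *)
  apply: le_ereal_inf_tmp => _ [[lam h] [/= lam0 ch hD] <-].
  apply: ge_ereal_sup => _ [p [kp cp] <-].
  have supp : (kernel_integral mu p h <=
      ereal_sup [set kernel_integral mu p h | p in kernel_in mu K])%E.
    by apply: ereal_sup_ubound; exists p.
  apply: (le_trans _ (leeD2l _ (le_trans (hD p kp) supp))).
  have cp' : kint mu p c <= eps by rewrite -lee_fin -KE.
  rewrite (KE p l kp cl) (KE p _ kp (clc lam)) -EFinD lee_fin kB//.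
  rewrite addrCA lerDl subr_ge0; exact: ler_wpM2l.
have I_ub p : Omega mu K c eps p -> ((kint mu p l)%:E <= I_Omega mu K c eps ell G)%E.
  by move=> Op; rewrite -(KE p l Op.1 cl); apply: ereal_sup_ubound; exists p.
have cptSS : compact [set: S * S] by rewrite -setXTT; exact: compact_setX.
have [M _ lM] := compact_bounded cptSS cl.
have kM p : kernel_in mu K p -> `|kint mu p l| <= M.
  by move=> [mp _]; exact: (kint_bound S_compact cpsi psi_app).
have I_fin : I_Omega mu K c eps ell G \is a fin_num.
  rewrite fin_numE; apply/andP; split; apply/eqP => IE.
    have [p Op] := Omega_neq0; have := I_ub _ Op; rewrite IE leeNy_eq.
    by [].
  suff : (I_Omega mu K c eps ell G <= M%:E)%E by rewrite IE leye_eq.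
  apply: ge_ereal_sup => _ [p [kp _] <-]; rewrite KE// lee_fin.
  by rewrite (le_trans (ler_norm _))// kM.
(* The slack [e] makes [v] strictly larger than the finite number [I_Omega], which the limit
   argument needs for its contradiction. *)
apply/lee_addgt0Pr => e e0.
pose v := fine (I_Omega mu K c eps ell G) + e.
have -> : (I_Omega mu K c eps ell G + e%:E = v%:E)%E by rewrite EFinD fineK.
have mix_in := @kernel_in_mixture R S S_compact open_app mu K K_ae.
have kmix p q (t : R) (t01 : 0 <= t <= 1) h : kernel_in mu K p ->
    kernel_in mu K q -> continuous h ->
    kint mu (mixture_kernel p q t01) h = t * kint mu p h + (1 - t) * kint mu q h.
  by move=> [mp _] [mq _] ch; exact: (kint_mixture S_compact cpsi psi_app).
have [eta eta0 etaP] : exists2 eta : R, 0 < eta & forall p, kernel_in mu K p ->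
    kint mu p c < eps + eta -> kint mu p l <= v.
  apply: contrapT => noeta.
  (* Kernels that defeat [eta = 1/(j+1)], with closed inequalities so that mixtures and limits
     preserve them; an empty [D j] would make this [eta] valid. *)
  pose D (j : nat) := [set p | kernel_in mu K p /\
    (kint mu p c <= eps + j.+1%:R^-1 /\ v <= kint mu p l)].
  have [||||p [q [Dp kq pq]]] := @kernel_in_limit R S S_compact open_app n x psi
    cpsi psi01 psi_app mu K K_ae D.
  - move=> j; apply: contrapT => /forallNP Dj; apply: noeta.
    exists j.+1%:R^-1; first by rewrite invr_gt0.
    move=> p kp cp; rewrite leNgt; apply/negP => vl; apply: (Dj p).
    by split => //; split; exact: ltW.
  - move=> j m jm p [kp [cp vp]]; split => //; split => //.
    by rewrite (le_trans cp)// lerD2l lef_pV2 ?posrE// ler_nat.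
  - by move=> j p [].
  - move=> j p q t t01 [kp [cp vp]] [kq [cq vq]]; split; first exact: mix_in.
    have t0 : 0 <= t by case/andP: t01.
    have u0 : 0 <= 1 - t by exact: onem_ge0_itv.
    rewrite !kmix//; split.
      apply: (le_trans (lerD (ler_wpM2l t0 cp) (ler_wpM2l u0 cq))).
      by rewrite -mulrDl addrC subrK mul1r.
    apply: (le_trans _ (lerD (ler_wpM2l t0 vp) (ler_wpM2l u0 vq))).
    by rewrite -mulrDl addrC subrK mul1r.
  (* The limit [q] has cost at most [eps + d] for every [d > 0], so it is admissible, while its
     value is at least [v > I_Omega]. *)
  have Oq : Omega mu K c eps q.
    split => //; rewrite KE// lee_fin; apply/ler_addgt0Pr => d d0.
    apply: (cvgr_to_le (pq c c_continuous)); near=> j.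
    have [_ [+ _]] := Dp j; move=> /le_trans; apply; rewrite lerD2l ltW//.
    by near: j; exact: near_infty_natSinv_lt (PosNum d0).
  have : v <= kint mu q l.
    apply: (cvgr_to_ge (pq l cl)); apply: nearW => j.
    by have [_ []] := Dp j.
  have := I_ub _ Oq; rewrite -(fineK I_fin) lee_fin => ql /le_trans/(_ ql).
  by rewrite leNgt /v ltrDl e0.
have [||lam lam0 lamP] := @lagrange_multiplier R _ (kernel_in mu K)
    (fun p => kint mu p c) (fun p => kint mu p l) eps v eta M eta0 etaP.
- by move=> p kp; rewrite (le_trans (ler_norm _))// kM.
- move=> p q t t01 kp kq; exists (mixture_kernel p q t01); first exact: mix_in.
  by split; exact: kmix.
(* The pair [(lam, l - lam c)] satisfies the constraint of [Delta] with equality, and the bound from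
   the multiplier says that its dual value is at most [v]. *)
apply: (@le_trans _ _ ((lam * eps)%:E + ereal_sup
    [set kernel_integral mu p (fun sr => (l sr - lam * c sr)%R)
    | p in kernel_in mu K])%E).
  apply: ereal_inf_lbound; exists (lam, fun sr => l sr - lam * c sr) => //.
  by split => //= p kp.
rewrite -leeBrDl// -EFinB; apply: ge_ereal_sup => _ [p kp <-].
rewrite (KE p _ kp (clc lam)) kB// lee_fin lerBlDr.
by rewrite (le_trans (lamP p kp))// mulrBr addrA addrAC.
Unshelve. all: by end_near. Qed.
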